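(* Let $0<p\le1$ and $1/2<\beta<1$. Then $\mathcal{M}(Q_p^\beta(\mathbb{D}))=Q_p^\beta(\mathbb{D})$.
   Context: $\mathbb{D}$ is the open unit disc, $H(\mathbb{D})$ the space of analytic functions on $\mathbb{D}$, $dA=\frac1\pi dx\,dy$, and $\sigma_a(z)=\frac{a-z}{1-\overline{a}z}$ for $a\in\mathbb{D}$. $Q_p^\beta(\mathbb{D})$ is the Banach space of all $f\in H(\mathbb{D})$ with $$\|f\|_{Q_p^\beta(\mathbb{D})}=|f(0)|+\sup_{a\in\mathbb{D}}\left(\int_{\mathbb{D}}|f'(z)|^2(1-|z|^2)^{4\beta-4}(1-|\sigma_a(z)|^2)^{p+2-2\beta}dA(z)\right)^{1/2}<\infty.$$ (Equivalently, $\sup_{I\subset\mathbb{T}}|I|^{-(p+2-2\beta)}\int_{S(I)}|f'(z)|^2(1-|z|^2)^{p-2+2\beta}dA(z)<\infty$, where $I$ ranges over the arcs of the unit circle $\mathbb{T}$, $|I|$ is the length of $I$ divided by $2\pi$, and $S(I)=\{z\in\mathbb{D}:1-|I|\le|z|<1,\ z/|z|\in I\}$.) For a Banach space $X$ of analytic functions on $\mathbb{D}$, $g\in H(\mathbb{D})$ is a pointwise multiplier on $X$ if $gX\subset X$, i.e. $gf\in X$ for all $f\in X$; $\mathcal{M}(X)$ denotes the set of all pointwise multipliers on $X$. *)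

(* Defs.v *)
From HB Require Import structures.
From mathcomp Require Import all_boot all_order all_algebra.
From mathcomp Require Import complex.
From mathcomp Require Import all_classical all_reals all_analysis.
Import Order.TTheory GRing.Theory Num.Theory.
Import numFieldNormedType.Exports.

Set Implicit Arguments.
Unset Strict Implicit.
Unset Printing Implicit Defensive.

Local Open Scope classical_set_scope.
Local Open Scope ring_scope.

(* The complex plane is [R[i]].  The generic norm [`|z|] is valued in [R[i]];
   [cabs] is the modulus as an element of [R]. *)
Definition cabs (R : realType) (z : R[i]) : R := ComplexField.Normc.normc z.

Definition unit_disc (R : realType) : set R[i] := [set z | cabs z < 1].

(* Functions on the disc are represented by total functions on [R[i]]; nothing
   below depends on their values outside the (open) disc.  [R[i]^o] is [R[i]] as
   a normed space over itself, so [derivable f z 1] is complex differentiability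
   at [z] and [derive1 f] is the complex derivative. *)
Definition analytic_disc (R : realType) : set (R[i] -> R[i]) :=
  [set f : R[i] -> R[i] | forall z, unit_disc z ->
    derivable (f : R[i]^o -> R[i]^o) (z : R[i]^o) 1].

Definition sigma_disc (R : realType) (a z : R[i]) : R[i] :=
  (a - z) / (1 - conjc a * z).

(* Integral over the disc with respect to dA = dx dy / pi. *)
Definition disc_integral (R : realType) (F : R[i] -> R) : \bar R :=
  ((pi^-1)%:E *
   \int[(@lebesgue_measure R \x @lebesgue_measure R)%E]_(w in
          [set w : R * R | @unit_disc R (Complex w.1 w.2)])
     (F (Complex w.1 w.2))%:E)%E.

Definition Qpb_integrand (R : realType) (p b : R) (f : R[i] -> R[i])
    (a z : R[i]) : R :=
  cabs (derive1 (f : R[i]^o -> R[i]^o) z) ^+ 2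
  * (1 - cabs z ^+ 2) `^ (4 * b - 4)
  * (1 - cabs (sigma_disc a z) ^+ 2) `^ (p + 2 - 2 * b).

(* Extended-real valued, with value [+oo] when the supremum is infinite. *)
Definition Qpb_norm (R : realType) (p b : R) (f : R[i] -> R[i]) : \bar R :=
  ((cabs (f 0%R))%:E +
   ereal_sup [set sqrte (disc_integral (Qpb_integrand p b f a))
             | a in @unit_disc R])%E.

Definition Qpb (R : realType) (p b : R) : set (R[i] -> R[i]) :=
  [set f : R[i] -> R[i] | analytic_disc f /\ (Qpb_norm p b f < +oo)%E].

(* Being a multiplier only involves the underlying set of the Banach space. *)
Definition multipliers (R : realType) (X : set (R[i] -> R[i])) :
    set (R[i] -> R[i]) :=
  [set g : R[i] -> R[i] | analytic_disc g /\ forall f, X f -> X (fun z => g z * f z)].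

(* Main.v *)
From HB Require Import structures.
Require Import Defs.
From mathcomp Require Import all_boot all_order all_algebra.
From mathcomp Require Import complex.
From mathcomp Require Import all_classical all_reals all_analysis.
From mathcomp Require Import measurable_realfun ring lra.
Import Order.TTheory GRing.Theory Num.Theory.
Import numFieldNormedType.Exports.
Set Implicit Arguments.
Unset Strict Implicit.
Unset Printing Implicit Defensive.
Local Open Scope classical_set_scope.
Local Open Scope ring_scope.

(** A function f of the space is automatically bounded, and this is the whole
    content of the theorem.  Once the space is known to consist of bounded
    functions, (fg)' = f'g + fg' gives
      |(fg)'|^2 <= 2 |g|^2 |f'|^2 + 2 |f|^2 |g'|^2,
    so the product of two members is a member ([QpbM]): every member is a
    multiplier.  Conversely the constant 1 is a member, so a multiplier g is a
    member because g = g * 1.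

    Boundedness comes from the value of the seminorm integral at the point a
    itself.  Put d = 1 - |a|.  On the square of half side d/4 around a the
    quantity 1 - |z|^2 is comparable to d and 1 - |sigma_a(z)|^2 is bounded
    below, hence the integral of |f'|^2 over that square is at most a constant
    times d^(4-4b).  A sub-mean-value inequality for |f'|^2
    ([local_L2_bound]) turns this into |f'(a)| <= K d^(1-2b)
    ([Qpb_derivative_growth]).  As b < 1, the exponent 1-2b exceeds -1, so this
    bound is integrable along radii and f is bounded ([Qpb_bounded]).

    The sub-mean-value inequality has to be obtained for functions that are only
    assumed complex differentiable at each point.  All contours are boundaries
    of rectangles, so that integrals over contours and over the plane are linked
    by Tonelli's theorem in Cartesian coordinates.  Goursat's theorem
    ([goursat], by bisection) shows that contours around a can be shrunk to a;
    this gives, with W the integral of 1/(z-a) around a rectangle,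
      f'(a) W = integral of (f(z)-f(a))/(z-a)^2      ([cauchy_derivative]).
    The right-hand side depends continuously on a, so f' is continuous
    ([cderive_continuous]), and an integration by parts yields
      f'(a) W = integral of f'(z)/(z-a)      ([cauchy_formula_derivative]).
    Since |W| >= 4, |f'(a)|^2 is controlled by the integrals of |f'|^2 over the
    four sides ([four_sides_bound]).  The sides may be moved independently, and
    averaging over their positions gives the bound by an area integral. *)

(** * Modulus and complex derivative *)
Section modulus.
Context {R : realType}.
Implicit Types z w : R[i].

Lemma cabs_norm z : `|z : R[i]^o| = (cabs z)%:C%C.
Proof. by []. Qed.

Lemma cabs_ge0 z : 0 <= cabs z.
Proof. by case: z => a b; exact: sqrtr_ge0. Qed.

Lemma cabsM z w : cabs (z * w) = cabs z * cabs w.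
Proof. exact: ComplexField.Normc.normcM. Qed.

Lemma cabsV z : cabs z^-1 = (cabs z)^-1.
Proof. exact: ComplexField.Normc.normcV. Qed.

Lemma cabsN z : cabs (- z) = cabs z.
Proof. exact: normcN. Qed.

Lemma cabsD z w : cabs (z + w) <= cabs z + cabs w.
Proof. exact: le_normcD. Qed.

Lemma cabsC (x : R) : cabs x%:C%C = `|x|.
Proof. by rewrite /cabs/= expr0n/= addr0 sqrtr_sqr. Qed.

Lemma cabs_eq0 z : (cabs z == 0) = (z == 0).
Proof.
apply/eqP/eqP => [/ComplexField.Normc.eq0_normc //|->].
exact: ComplexField.Normc.normc0.
Qed.

Lemma cabs0 : cabs (0 : R[i]) = 0.
Proof. exact: ComplexField.Normc.normc0. Qed.

Lemma cabs_conj z : cabs (conjc z) = cabs z.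
Proof. by case: z => u v; rewrite /cabs/= sqrrN. Qed.

Lemma cabs_gt0 z : (0 < cabs z) = (z != 0).
Proof. by rewrite lt_def cabs_ge0 andbT cabs_eq0. Qed.

Lemma cabs_sqr z : cabs z ^+ 2 = complex.Re z ^+ 2 + complex.Im z ^+ 2.
Proof. by case: z => a b; rewrite /cabs /= sqr_sqrtr// addr_ge0// sqr_ge0. Qed.

Lemma ler_Re_cabs z : `|complex.Re z| <= cabs z.
Proof.
rewrite -(@ler_pXn2r _ 2)// ?nnegrE ?cabs_ge0// cabs_sqr real_normK ?num_real//.
by rewrite lerDl sqr_ge0.
Qed.

Lemma ler_Im_cabs z : `|complex.Im z| <= cabs z.
Proof.
rewrite -(@ler_pXn2r _ 2)// ?nnegrE ?cabs_ge0// cabs_sqr real_normK ?num_real//.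
by rewrite lerDr sqr_ge0.
Qed.

Lemma cabs_le_ReIm z : cabs z <= `|complex.Re z| + `|complex.Im z|.
Proof.
rewrite -(@ler_pXn2r _ 2)// ?nnegrE ?cabs_ge0 ?addr_ge0// cabs_sqr sqrrD.
rewrite !real_normK ?num_real// -addrA [X in _ <= _ + X]addrC addrA lerDl.
by rewrite mulrn_wge0// mulr_ge0.
Qed.

End modulus.

Section topology.
Context {R : realType}.
Implicit Types f h : R[i] -> R[i].

Lemma continuous_cabsP h (z : R[i]) :
  {for z, continuous (h : R[i]^o -> R[i]^o)} <->
  forall e : R, 0 < e -> exists2 d, 0 < d & forall w, cabs (w - z) < d ->
    cabs (h w - h z) < e.
Proof.
split.
- move=> /cvgrPdist_lt hz e e0.
  have /hz : 0 < e%:C%C :> R[i] by rewrite ltcE/= eqxx.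
  move=> /nbhs_ballP [d /= d0 hd].
  have [d1 [d1E d2]] : exists d1 : R, d1%:C%C = d /\ 0 < d1.
    exists (complex.Re d); move: d0; rewrite ltcE /= => /andP[/eqP + ->].
    by case: (d) => a b /= ->.
  exists d1 => // w wz.
  have := hd w; rewrite -ball_normE/= distrC cabs_norm -d1E ltcR => /(_ wz).
  by rewrite distrC cabs_norm ltcR.
- move=> H; apply/(@cvgrPdist_lt R[i] R[i]^o _ (nbhs (z : R[i]^o))) => e.
  rewrite ltcE/= => /andP[/eqP Ime e0].
  have [d d0 hd] := H _ e0.
  apply/nbhs_ballP; exists d%:C%C; rewrite /= ?ltcE/= ?eqxx// => w.
  rewrite -ball_normE/= distrC cabs_norm ltcR => /hd.
  rewrite distrC cabs_norm; case: e Ime e0 {hd} => a b /= -> _.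
  by rewrite ltcR.
Qed.

(** Stated without a quotient: the linear approximation of f can then be
    integrated over a contour as it stands. *)
Definition cderiv f (z l : R[i]) := forall e : R, 0 < e ->
  exists2 d, 0 < d & forall w, cabs (w - z) < d ->
    cabs (f w - f z - l * (w - z)) <= e * cabs (w - z).

Let quotient_identity (l q t : R[i]) : q != 0 ->
  (t - l * q) * q^-1 = - (l - q^-1 * t).
Proof. by move=> q0; field. Qed.

Lemma derivable_cderiv f (z : R[i]) :
  derivable (f : R[i]^o -> R[i]^o) (z : R[i]^o) 1 ->
  cderiv f z (derive1 (f : R[i]^o -> R[i]^o) z).
Proof.
move=> fz e e0.
move: (fz) => /(@cvgrPdist_le _ R[i]^o) Hl.
rewrite derive1E.
have /Hl : 0 < e%:C%C :> R[i] by rewrite ltcE/= eqxx.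
move=> /nbhs_ballP [d /= d0 hd].
have [d1 [d1E d2]] : exists d1 : R, d1%:C%C = d /\ 0 < d1.
  exists (complex.Re d); move: d0; rewrite ltcE /= => /andP[/eqP + ->].
  by case: (d) => a b /= ->.
exists d1 => // w wz.
have [->|wz0] := eqVneq w z; first by rewrite !subrr mulr0 subrr cabs0 mulr0.
have := hd (w - z); rewrite -ball_normE/= distrC subr0 cabs_norm -d1E ltcR.
rewrite subr_eq0 => /(_ wz wz0).
rewrite /= [(w - z) *: _]mulr1 subrK cabs_norm lecR => H.
rewrite -ler_pdivrMr ?cabs_gt0 ?subr_eq0// -cabsV -cabsM.
apply: le_trans H; rewrite -[leRHS]cabsN le_eqVlt; apply/orP; left; apply/eqP.
congr cabs.
by apply: quotient_identity; rewrite subr_eq0.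
Qed.

Lemma is_derive_cderivP f (z l : R[i]) :
  is_derive (z : R[i]^o) 1 (f : R[i]^o -> R[i]^o) l <-> cderiv f z l.
Proof.
split.
  move=> [fz <-]; rewrite -derive1E; exact: derivable_cderiv.
move=> H.
suff Hl : h^-1 *: (((f : R[i]^o -> R[i]^o) \o shift (z : R[i]^o)) (h *: (1 : R[i]^o)) - f z)
   @[h --> (0 : R[i]^o)^'] --> (l : R[i]^o).
  apply: DeriveDef; first by apply: cvgP Hl.
  exact: cvg_lim Hl.
apply/(@cvgrPdist_le R[i] R[i]^o) => e.
rewrite ltcE/= => /andP[/eqP Ime e0].
have [d d0 hd] := H _ e0.
apply/nbhs_ballP; exists d%:C%C; rewrite /= ?ltcE/= ?eqxx// => w.
rewrite -ball_normE/= distrC subr0 cabs_norm ltcR => wd w0.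
have := hd (w + z); rewrite addrK => /(_ wd).
rewrite [w *: _]mulr1 cabs_norm.
case: e Ime e0 {hd} => a b /= -> a0; rewrite lecR.
rewrite -ler_pdivrMr ?cabs_gt0// -cabsV -cabsM.
apply: le_trans; rewrite -[leLHS]cabsN le_eqVlt; apply/orP; left; apply/eqP.
congr cabs; symmetry; exact: quotient_identity.
Qed.

End topology.

(** * Differentiation rules and restriction to lines *)
Section rules.
Context {R : realType}.
Implicit Types (f g h : R[i] -> R[i]) (z l m : R[i]).

Lemma cderiv_derivable f z l : cderiv f z l ->
  derivable (f : R[i]^o -> R[i]^o) (z : R[i]^o) 1.
Proof. by move=> /is_derive_cderivP []. Qed.

Lemma cderiv_derive1 f z l : cderiv f z l ->
  derive1 (f : R[i]^o -> R[i]^o) z = l.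
Proof. by move=> /is_derive_cderivP [_ <-]; rewrite derive1E. Qed.

Lemma cderiv_cst (c : R[i]) z : cderiv (fun=> c) z 0.
Proof. apply/is_derive_cderivP; exact: is_derive_cst. Qed.

Lemma cderiv_id z : cderiv id z 1.
Proof. apply/is_derive_cderivP; exact: is_derive_id. Qed.

Lemma cderivD f g z l m : cderiv f z l -> cderiv g z m ->
  cderiv (fun w => f w + g w) z (l + m).
Proof.
move=> /is_derive_cderivP fz /is_derive_cderivP gz.
apply/is_derive_cderivP; exact: is_deriveD.
Qed.

Lemma cderivB f g z l m : cderiv f z l -> cderiv g z m ->
  cderiv (fun w => f w - g w) z (l - m).
Proof.
move=> /is_derive_cderivP fz /is_derive_cderivP gz.
apply/is_derive_cderivP; exact: is_deriveB.
Qed.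

Lemma cderivM f g z l m : cderiv f z l -> cderiv g z m ->
  cderiv (fun w => f w * g w) z (l * g z + f z * m).
Proof.
move=> /is_derive_cderivP fz /is_derive_cderivP gz.
rewrite addrC mulrC [l * _]mulrC [m * _]mulrC.
apply/is_derive_cderivP; exact: (is_deriveM (R := R[i]) (V := R[i]^o)).
Qed.

Lemma cderivV f z l : f z != 0 -> cderiv f z l ->
  cderiv (fun w => (f w)^-1) z (- l / f z ^+ 2).
Proof.
move=> fz0 /is_derive_cderivP [fz fl].
apply/is_derive_cderivP; apply: DeriveDef.
  exact: (derivableV (R := R[i]) (V := R[i]^o)).
have := deriveV (R := R[i]) (V := R[i]^o) fz0 fz.
move=> /= ->; rewrite fl.
have comm_opp (u c : R[i]) : - u * c = - c * u by ring.
exact: comm_opp.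
Qed.

Lemma cderiv_shift f (a z l : R[i]) : cderiv f (a + z) l ->
  cderiv (fun w => f (a + w)) z l.
Proof.
move=> H e /H[d d0 hd]; exists d => // w wz.
have E : a + w - (a + z) = w - z by ring.
by have := hd (a + w); rewrite E => /(_ wz).
Qed.

Lemma cderiv_continuous f z l : cderiv f z l ->
  {for z, continuous (f : R[i]^o -> R[i]^o)}.
Proof.
move=> /is_derive_cderivP [fz _].
by apply: differentiable_continuous; apply/derivable1_diffP.
Qed.

(** The parameter w stays complex, so that the chain rule applies inside the
    complex theory; real differentiability along a line is read off
    afterwards by [is_derive_Re] and [is_derive_Im]. *)
Lemma cderiv_line f (z0 v l : R[i]) (t : R) : cderiv f (z0 + t%:C%C * v) l ->
  cderiv (fun w => f (z0 + w * v)) t%:C%C (v * l).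
Proof.
move=> H e e0.
have [->|v0] := eqVneq v 0.
  exists 1 => // w _; rewrite !mulr0 addr0 subrr !mul0r subrr cabs0.
  by rewrite mulr_ge0 ?(ltW e0)// cabs_ge0.
have cv0 : 0 < cabs v by rewrite cabs_gt0.
have [d d0 hd] := H (e / cabs v) (divr_gt0 e0 cv0).
exists (d / cabs v); first exact: divr_gt0.
move=> w; rewrite ltr_pdivlMr// -cabsM mulrBl => wd.
have E : z0 + w * v - (z0 + t%:C%C * v) = w * v - t%:C%C * v by ring.
have := hd (z0 + w * v); rewrite E => /(_ wd).
rewrite -mulrBl [X in _ <= _ * X]cabsM.
have -> : e / cabs v * (cabs (w - t%:C%C) * cabs v) = e * cabs (w - t%:C%C).
  by field; rewrite gt_eqF.
by rewrite [v * l]mulrC -mulrA [(w - _) * v]mulrC.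
Qed.

Let real_deriv (P : R -> R) (t l : R) :
  (forall e : R, 0 < e -> exists2 d, 0 < d & forall s, `|s - t| < d ->
    `|P s - P t - l * (s - t)| <= e * `|s - t|) -> is_derive t 1 P l.
Proof.
move=> H.
suff Hl : h^-1 *: ((P \o shift t) (h *: (1 : R)) - P t) @[h --> (0 : R)^'] --> l.
  apply: DeriveDef; first by apply: cvgP Hl.
  exact: cvg_lim Hl.
apply/cvgrPdist_le => e e0.
have [d d0 hd] := H _ e0.
apply/nbhs_ballP; exists d; rewrite //= => w.
rewrite -ball_normE/= distrC subr0 => wd w0.
have := hd (w + t); rewrite addrK => /(_ wd).
rewrite [w *: _]mulr1.
rewrite -ler_pdivrMr ?normr_gt0// -normfV -normrM.
apply: le_trans; rewrite -[leLHS]normrN le_eqVlt; apply/orP; left; apply/eqP.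
by congr `|_|; rewrite /GRing.scale/=; field.
Qed.

Lemma is_derive_Re f (t : R) (l : R[i]) : cderiv f t%:C%C l ->
  is_derive t 1 (fun s : R => complex.Re (f s%:C%C)) (complex.Re l).
Proof.
move=> H; apply: real_deriv => e /H[d d0 hd]; exists d => // s sd.
have /hd : cabs (s%:C%C - t%:C%C) < d by rewrite -rmorphB cabsC.
rewrite -rmorphB cabsC; apply: le_trans; apply: le_trans (ler_Re_cabs _).
by rewrite -!raddfB/=; case: (f _) => ? ?; case: (f _) => ? ?; case: l {H hd} => ? ?/=;
  rewrite ?mulr0 ?subr0 ?oppr0 ?addr0.
Qed.

Lemma is_derive_Im f (t : R) (l : R[i]) : cderiv f t%:C%C l ->
  is_derive t 1 (fun s : R => complex.Im (f s%:C%C)) (complex.Im l).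
Proof.
move=> H; apply: real_deriv => e /H[d d0 hd]; exists d => // s sd.
have /hd : cabs (s%:C%C - t%:C%C) < d by rewrite -rmorphB cabsC.
rewrite -rmorphB cabsC; apply: le_trans; apply: le_trans (ler_Im_cabs _).
by case: (f _) => ? ?; case: (f _) => ? ?; case: l {H hd} => ? ?/=;
  rewrite ?mulr0 ?subr0 ?oppr0 ?addr0 ?add0r.
Qed.

Lemma continuous_Re : continuous (@complex.Re R : R[i]^o -> R).
Proof.
move=> z; apply/(@cvgrPdist_lt R R _ (nbhs (z : R[i]^o))) => e e0.
apply/nbhs_ballP; exists e%:C%C; rewrite /= ?ltcE/= ?eqxx// => w.
rewrite -ball_normE/= cabs_norm ltcR; apply: le_lt_trans.
by rewrite -raddfB; exact: ler_Re_cabs.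
Qed.

Lemma continuous_Im : continuous (@complex.Im R : R[i]^o -> R).
Proof.
move=> z; apply/(@cvgrPdist_lt R R _ (nbhs (z : R[i]^o))) => e e0.
apply/nbhs_ballP; exists e%:C%C; rewrite /= ?ltcE/= ?eqxx// => w.
rewrite -ball_normE/= cabs_norm ltcR; apply: le_lt_trans.
by rewrite -raddfB; exact: ler_Im_cabs.
Qed.

Lemma continuous_cabs : continuous (@cabs R : R[i]^o -> R).
Proof.
move=> z; apply/(@cvgrPdist_lt R R _ (nbhs (z : R[i]^o))) => e e0.
apply/nbhs_ballP; exists e%:C%C; rewrite /= ?ltcE/= ?eqxx// => w.
rewrite -ball_normE/= cabs_norm ltcR; apply: le_lt_trans.
have zw := cabsD (z - w) w; have wz := cabsD (w - z) z.
rewrite !subrK in zw wz; rewrite -[cabs (w - z)]cabsN opprB in wz.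
by rewrite ler_norml; lra.
Qed.

Lemma continuous_Re_comp (h : R -> R[i]) t : {for t, continuous (h : R -> R[i]^o)} ->
  {for t, continuous (fun s => complex.Re (h s))}.
Proof.
by move=> hc; exact: (@continuous_comp R R[i]^o R h (@complex.Re R) t hc (@continuous_Re _)).
Qed.

Lemma continuous_Im_comp (h : R -> R[i]) t : {for t, continuous (h : R -> R[i]^o)} ->
  {for t, continuous (fun s => complex.Im (h s))}.
Proof.
by move=> hc; exact: (@continuous_comp R R[i]^o R h (@complex.Im R) t hc (@continuous_Im _)).
Qed.

Lemma continuous_cabs_comp (h : R -> R[i]) t : {for t, continuous (h : R -> R[i]^o)} ->
  {for t, continuous (fun s => cabs (h s))}.
Proof.
by move=> hc; exact: (@continuous_comp R R[i]^o R h (@cabs R) t hc (@continuous_cabs _)).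
Qed.

Lemma continuous_line (z0 v : R[i]) :
  continuous (fun s : R => z0 + s%:C%C * v : R[i]^o).
Proof.
move=> t; apply/(@cvgrPdist_lt R[i] R[i]^o) => e.
rewrite ltcE/= => /andP[/eqP Ime e0].
case: e Ime e0 => a b /= -> {b} a0.
have v1 : 0 < cabs v + 1 by rewrite ltr_wpDl ?cabs_ge0.
apply/nbhs_ballP; exists (a / (cabs v + 1)); rewrite /= ?divr_gt0// => w /= tw.
rewrite opprD addrACA subrr add0r -mulrBl -rmorphB/= cabs_norm ltcR cabsM cabsC.
apply: le_lt_trans (_ : `|t - w| * (cabs v + 1) < _).
  by rewrite ler_wpM2l// lerDl.
by rewrite -ltr_pdivlMr.
Qed.

Lemma continuous_comp_line (f : R[i] -> R[i]) (z0 v : R[i]) (t : R) :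
  {for z0 + t%:C%C * v, continuous (f : R[i]^o -> R[i]^o)} ->
  {for t, continuous (fun s : R => f (z0 + s%:C%C * v) : R[i]^o)}.
Proof.
move=> fc.
have := @continuous_comp R R[i]^o R[i]^o (fun s : R => z0 + s%:C%C * v) f t (@continuous_line z0
  v t) fc.
exact.
Qed.

Lemma continuous_mulc (T : topologicalType) (h : T -> R[i]) (v : R[i]) (t : T) :
  {for t, continuous (h : T -> R[i]^o)} ->
  {for t, continuous (fun s : T => v * h s : R[i]^o)}.
Proof.
move=> hc.
have := @continuousM R[i] T (fun=> v) h t (@cst_continuous T R[i]^o v t) hc.
exact.
Qed.

Lemma continuous_add (T : topologicalType) (h k : T -> R[i])  (t : T) :
  {for t, continuous (h : T -> R[i]^o)} ->
  {for t, continuous (k : T -> R[i]^o)} ->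
  {for t, continuous (fun s : T => h s + k s : R[i]^o)}.
Proof.
move=> hc kc.
have := @continuousD R[i] R[i]^o T h k t hc kc.
exact.
Qed.

End rules.

(** * Integrals over segments *)
Section real_integral.
Context {R : realType}.
Notation mu := (@lebesgue_measure R).
Implicit Types (P Q : R -> R) (a b c t : R).

Lemma segment_integrable P a b :
  (forall t, a <= t <= b -> {for t, continuous P}) ->
  mu.-integrable `[a, b] (EFin \o P).
Proof.
move=> Pc; apply: continuous_compact_integrable; first exact: segment_compact.
by apply: continuous_in_subspaceT => t; rewrite inE/= in_itv/= => /Pc.
Qed.

Lemma Rintegral_add P a b c : a <= c <= b ->
  (forall t, a <= t <= b -> {for t, continuous P}) ->
  \int[mu]_(t in `[a, b]) P t =
  \int[mu]_(t in `[a, c]) P t + \int[mu]_(t in `[c, b]) P t.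
Proof.
move=> /andP[ac cb] Pc.
have iP := segment_integrable Pc.
have := @Rintegral_itvB _ P (BLeft a) (BRight b) c iP.
rewrite !bnd_simp => /(_ ac cb).
rewrite (Rintegral_itv_obnd_cbnd (b := BRight b)); last first.
  apply: integrableS iP => //; apply: subset_itvr; rewrite bnd_simp; exact: ac.
by move=> <-; rewrite addrC subrK.
Qed.

Lemma Rintegral_lin P Q (al be : R) a b :
  (forall t, a <= t <= b -> {for t, continuous P}) ->
  (forall t, a <= t <= b -> {for t, continuous Q}) ->
  \int[mu]_(t in `[a, b]) (al * P t + be * Q t) =
  al * \int[mu]_(t in `[a, b]) P t + be * \int[mu]_(t in `[a, b]) Q t.
Proof.
move=> Pc Qc.
have iP := segment_integrable Pc.
have iQ := segment_integrable Qc.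
rewrite RintegralD//=.
- by rewrite !RintegralZl.
- by apply: eq_integrable (integrableZl _ al iP) => //.
- by apply: eq_integrable (integrableZl _ be iQ) => //.
Qed.

Lemma Rintegral_FTC P (F : R -> R) a b : a <= b ->
  (forall t, a <= t <= b -> {for t, continuous P}) ->
  (forall t, a <= t <= b -> is_derive t 1 F (P t)) ->
  \int[mu]_(t in `[a, b]) P t = F b - F a.
Proof.
rewrite le_eqVlt => /predU1P[<- _ _|ab Pc FP].
  by rewrite set_itv1 Rintegral_set1 subrr.
rewrite /Rintegral (@continuous_FTC2 _ P F)//.
- by apply: continuous_in_subspaceT => t; rewrite inE/= in_itv/= => /Pc.
- have Fc t : a <= t <= b -> {for t, continuous F}.
    move=> /FP [Ft _]; apply: differentiable_continuous.
    exact/derivable1_diffP.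
  split.
  + by move=> t; rewrite in_itv/= => /andP[/ltW at' /ltW tb]; have [] := FP t (introT andP (conj
    at' tb)).
  + by apply: cvg_at_right_filter; apply: Fc; rewrite lexx ltW.
  + by apply: cvg_at_left_filter; apply: Fc; rewrite lexx ltW.
- move=> t; rewrite in_itv/= => /andP[/ltW at' /ltW tb].
  by rewrite derive1E; have [_ ->] := FP t (introT andP (conj at' tb)).
Qed.

End real_integral.

Section complex_integral.
Context {R : realType}.
Notation mu := (@lebesgue_measure R).
Implicit Types (h k : R -> R[i]) (a b c t : R).

Definition cint h a b : R[i] :=
  Complex (\int[mu]_(t in `[a, b]) complex.Re (h t))
          (\int[mu]_(t in `[a, b]) complex.Im (h t)).

Lemma eq_cint h k a b : (forall t, a <= t <= b -> h t = k t) ->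
  cint h a b = cint k a b.
Proof.
by move=> hk; congr Complex; apply: eq_Rintegral => t; rewrite inE/= in_itv/= => /hk ->.
Qed.

Lemma cint_add h a b c : a <= c <= b ->
  (forall t, a <= t <= b -> {for t, continuous (h : R -> R[i]^o)}) ->
  cint h a b = cint h a c + cint h c b.
Proof.
move=> acb hc; rewrite /cint.
rewrite (Rintegral_add acb); last by move=> t /hc /continuous_Re_comp.
by rewrite (Rintegral_add acb)// => t /hc /continuous_Im_comp.
Qed.

Lemma cint_lin (al be : R[i]) h k a b :
  (forall t, a <= t <= b -> {for t, continuous (h : R -> R[i]^o)}) ->
  (forall t, a <= t <= b -> {for t, continuous (k : R -> R[i]^o)}) ->
  cint (fun t => al * h t + be * k t) a b = al * cint h a b + be * cint k a b.
Proof.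
move=> hc kc.
have hr t : a <= t <= b -> {for t, continuous (fun s => complex.Re (h s))} by move=> /hc
  /continuous_Re_comp.
have hi t : a <= t <= b -> {for t, continuous (fun s => complex.Im (h s))} by move=> /hc
  /continuous_Im_comp.
have kr t : a <= t <= b -> {for t, continuous (fun s => complex.Re (k s))} by move=> /kc
  /continuous_Re_comp.
have ki t : a <= t <= b -> {for t, continuous (fun s => complex.Im (k s))} by move=> /kc
  /continuous_Im_comp.
have lc P Q (x y : R) :
  (forall t, a <= t <= b -> {for t, continuous P}) ->
  (forall t, a <= t <= b -> {for t, continuous Q}) ->
  (forall t, a <= t <= b -> {for t, continuous (fun t => x * P t + y * Q t)}).
  move=> Pc Qc t tab; apply: continuousD; apply: continuousM;
    [exact: cst_continuous|exact: Pc|exact: cst_continuous|exact: Qc].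
have lin4 (x y u v : R) :
  \int[mu]_(t in `[a, b]) (1 * (x * complex.Re (h t) + y * complex.Im (h t)) +
        1 * (u * complex.Re (k t) + v * complex.Im (k t))) =
  x * \int[mu]_(t in `[a, b]) complex.Re (h t) +
  y * \int[mu]_(t in `[a, b]) complex.Im (h t) +
  (u * \int[mu]_(t in `[a, b]) complex.Re (k t) +
   v * \int[mu]_(t in `[a, b]) complex.Im (k t)).
  by rewrite Rintegral_lin ?mul1r ?Rintegral_lin//; exact: lc.
case: al => x y; case: be => u v; rewrite /cint.
apply/eqP; rewrite eq_complex/=; apply/andP; split; apply/eqP.
- apply: etrans (etrans _ (lin4 x (- y) u (- v))) _; last by rewrite !mulNr.
  apply: eq_Rintegral => t _.
  by case: (h t) => ? ?; case: (k t) => ? ? /=; ring.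
- apply: etrans (etrans _ (lin4 y x v u)) _; last by ring.
  apply: eq_Rintegral => t _.
  by case: (h t) => ? ?; case: (k t) => ? ? /=; ring.
Qed.

(** Pairing the integral I with itself, |I|^2 is the integral of the real inner
    product of I with h, which is at most |I| |h| pointwise. *)
Lemma cabs_cint_le h a b :
  (forall t, a <= t <= b -> {for t, continuous (h : R -> R[i]^o)}) ->
  cabs (cint h a b) <= \int[mu]_(t in `[a, b]) cabs (h t).
Proof.
move=> hc.
have hr t : a <= t <= b -> {for t, continuous (fun s => complex.Re (h s))} by move=> /hc
  /continuous_Re_comp.
have hi t : a <= t <= b -> {for t, continuous (fun s => complex.Im (h s))} by move=> /hc
  /continuous_Im_comp.
have ha t : a <= t <= b -> {for t, continuous (fun s => cabs (h s))} by move=> /hc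
  /continuous_cabs_comp.
have [->|I0] := eqVneq (cint h a b) 0.
  rewrite cabs0; apply: Rintegral_ge0 => t _; exact: cabs_ge0.
set N := cabs (cint h a b).
pose x := complex.Re (cint h a b); pose y := complex.Im (cint h a b).
have Nxy : N ^+ 2 = x ^+ 2 + y ^+ 2 by exact: cabs_sqr.
rewrite -(@ler_pM2l _ N) ?cabs_gt0// -expr2 Nxy -RintegralZl//; last first.
  exact: segment_integrable.
have -> : x ^+ 2 + y ^+ 2 =
    \int[mu]_(t in `[a, b]) (x * complex.Re (h t) + y * complex.Im (h t)).
  by rewrite Rintegral_lin.
apply: le_Rintegral => //.
- apply: segment_integrable => t tab; apply: continuousD; apply: continuousM;
    [exact: cst_continuous|exact: hr|exact: cst_continuous|exact: hi].
- apply: segment_integrable => t tab; apply: continuousM;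
    [exact: cst_continuous|exact: ha].
move=> t _; apply: le_trans (ler_norm _) _.
rewrite -(@ler_pXn2r _ 2)// ?nnegrE ?mulr_ge0 ?cabs_ge0// exprMn Nxy cabs_sqr.
rewrite real_normK ?num_real// -subr_ge0; case: (h t) => u v/=.
suff -> : (x ^+ 2 + y ^+ 2) * (u ^+ 2 + v ^+ 2) - (x * u + y * v) ^+ 2 =
  (x * v - y * u) ^+ 2 by rewrite sqr_ge0.
by ring.
Qed.

End complex_integral.

(** * Integrals over the boundary of a rectangle *)
Section contour.
Context {R : realType}.
Notation mu := (@lebesgue_measure R).
Implicit Types (f g F : R[i] -> R[i]) (a b c t x y : R).

Definition hside f y a b := cint (fun t => f (Complex t y)) a b.
Definition vside f x a b := 'i%C * cint (fun t => f (Complex x t)) a b.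

(** The contour integral of f around the rectangle, counterclockwise. *)
Definition rect_integral f x1 x2 y1 y2 : R[i] :=
  hside f y1 x1 x2 + vside f x2 y1 y2 - hside f y2 x1 x2 - vside f x1 y1 y2.

Definition on_rect x1 x2 y1 y2 (z : R[i]) :=
  (x1 <= complex.Re z <= x2) && (y1 <= complex.Im z <= y2).

Definition on_boundary x1 x2 y1 y2 (z : R[i]) := on_rect x1 x2 y1 y2 z &&
  [|| complex.Re z == x1, complex.Re z == x2, complex.Im z == y1 | complex.Im z == y2].

Lemma horizontal_point t y : Complex t y = Complex 0 y + t%:C%C * 1.
Proof. by rewrite mulr1; apply/eqP; rewrite eq_complex/= add0r addr0 !eqxx. Qed.

Lemma vertical_point x t : Complex x t = Complex x 0 + t%:C%C * 'i%C.
Proof.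
by apply/eqP; rewrite eq_complex/= !mul0r mulr0 mulr1 subr0 !addr0 add0r !eqxx.
Qed.

Lemma continuous_hline f t y : {for Complex t y, continuous (f : R[i]^o -> R[i]^o)} ->
  {for t, continuous (fun s : R => f (Complex s y) : R[i]^o)}.
Proof.
rewrite [Complex t y]horizontal_point => /continuous_comp_line fc.
have -> : (fun s => f (Complex s y)) = (fun s => f (Complex 0 y + s%:C%C * 1)).
  by apply/funext => s; rewrite [Complex s y]horizontal_point.
exact: fc.
Qed.

Lemma continuous_vline f x t : {for Complex x t, continuous (f : R[i]^o -> R[i]^o)} ->
  {for t, continuous (fun s : R => f (Complex x s) : R[i]^o)}.
Proof.
rewrite [Complex x t]vertical_point => /continuous_comp_line fc.
have -> : (fun s => f (Complex x s)) = (fun s => f (Complex x 0 + s%:C%C * 'i%C)).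
  by apply/funext => s; rewrite [Complex x s]vertical_point.
exact: fc.
Qed.

Lemma cint_FTC f F (z0 v : R[i]) a b : a <= b ->
  (forall t, a <= t <= b -> {for t, continuous (fun s : R => f (z0 + s%:C%C * v) : R[i]^o)}) ->
  (forall t, a <= t <= b -> cderiv F (z0 + t%:C%C * v) (f (z0 + t%:C%C * v))) ->
  v * cint (fun t => f (z0 + t%:C%C * v)) a b =
  F (z0 + b%:C%C * v) - F (z0 + a%:C%C * v).
Proof.
move=> ab fc Ff.
have fvc t : a <= t <= b ->
    {for t, continuous (fun s : R => v * f (z0 + s%:C%C * v) : R[i]^o)}.
  by move=> /fc fct; exact: continuous_mulc.
have -> : v * cint (fun t => f (z0 + t%:C%C * v)) a b =
    cint (fun t => v * f (z0 + t%:C%C * v)) a b.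
  transitivity (cint (fun t => v * f (z0 + t%:C%C * v) + 0 * f (z0 + t%:C%C * v)) a b).
    by rewrite cint_lin// mul0r addr0.
  by apply: eq_cint => t _; rewrite mul0r addr0.
have dF t : a <= t <= b -> cderiv (fun w => F (z0 + w * v)) t%:C%C (v * f (z0 + t%:C%C * v)).
  by move=> /Ff; exact: cderiv_line.
apply/eqP; rewrite eq_complex; apply/andP; split; apply/eqP.
- apply: etrans (Rintegral_FTC (F := fun s : R => complex.Re (F (z0 + s%:C%C * v))) ab _ _) _.
  + move=> t /fvc tc; apply: (@continuous_comp R R[i]^o R _ (@complex.Re R) t tc).
    exact: continuous_Re.
  + by move=> t /dF; exact: is_derive_Re.
  + by rewrite raddfB.
- apply: etrans (Rintegral_FTC (F := fun s : R => complex.Im (F (z0 + s%:C%C * v))) ab _ _) _.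
  + move=> t /fvc tc; apply: (@continuous_comp R R[i]^o R _ (@complex.Im R) t tc).
    exact: continuous_Im.
  + by move=> t /dF; exact: is_derive_Im.
  + by rewrite raddfB.
Qed.

Lemma hside_FTC f F y a b : a <= b ->
  (forall t, a <= t <= b -> {for Complex t y, continuous (f : R[i]^o -> R[i]^o)}) ->
  (forall t, a <= t <= b -> cderiv F (Complex t y) (f (Complex t y))) ->
  hside f y a b = F (Complex b y) - F (Complex a y).
Proof.
move=> ab fc Ff.
transitivity (1 * cint (fun t => f (Complex 0 y + t%:C%C * 1)) a b).
  by rewrite mul1r; apply: eq_cint => t _; rewrite [Complex t y]horizontal_point.
rewrite [Complex b y]horizontal_point [Complex a y]horizontal_point.
apply: (@cint_FTC f F (Complex 0 y) 1 a b ab) => t tab.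
- by apply: continuous_comp_line; rewrite -horizontal_point; exact: fc.
- by rewrite -horizontal_point; exact: Ff.
Qed.

Lemma vside_FTC f F x a b : a <= b ->
  (forall t, a <= t <= b -> {for Complex x t, continuous (f : R[i]^o -> R[i]^o)}) ->
  (forall t, a <= t <= b -> cderiv F (Complex x t) (f (Complex x t))) ->
  vside f x a b = F (Complex x b) - F (Complex x a).
Proof.
move=> ab fc Ff.
transitivity ('i%C * cint (fun t => f (Complex x 0 + t%:C%C * 'i%C)) a b).
  by congr (_ * _); apply: eq_cint => t _; rewrite [Complex x t]vertical_point.
rewrite [Complex x b]vertical_point [Complex x a]vertical_point.
apply: (@cint_FTC f F (Complex x 0) 'i%C a b ab) => t tab.
- by apply: continuous_comp_line; rewrite -vertical_point; exact: fc.
- by rewrite -vertical_point; exact: Ff.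
Qed.

Section boundary.
Variables (x1 x2 y1 y2 : R).
Hypotheses (x12 : x1 <= x2) (y12 : y1 <= y2).

Lemma on_bd_bottom t : x1 <= t <= x2 -> on_boundary x1 x2 y1 y2 (Complex t y1).
Proof. by move=> tx; rewrite /on_boundary /on_rect/= tx lexx y12 eqxx !orbT. Qed.

Lemma on_bd_top t : x1 <= t <= x2 -> on_boundary x1 x2 y1 y2 (Complex t y2).
Proof. by move=> tx; rewrite /on_boundary /on_rect/= tx lexx y12 eqxx !orbT. Qed.

Lemma on_bd_left t : y1 <= t <= y2 -> on_boundary x1 x2 y1 y2 (Complex x1 t).
Proof. by move=> ty; rewrite /on_boundary /on_rect/= ty lexx x12 eqxx. Qed.

Lemma on_bd_right t : y1 <= t <= y2 -> on_boundary x1 x2 y1 y2 (Complex x2 t).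
Proof. by move=> ty; rewrite /on_boundary /on_rect/= ty lexx x12 eqxx !orbT. Qed.

(** The increments of a primitive along the four sides telescope. *)
Lemma rect_FTC f F :
  (forall z, on_boundary x1 x2 y1 y2 z -> {for z, continuous (f : R[i]^o -> R[i]^o)}) ->
  (forall z, on_boundary x1 x2 y1 y2 z -> cderiv F z (f z)) ->
  rect_integral f x1 x2 y1 y2 = 0.
Proof.
move=> fc Ff; rewrite /rect_integral.
rewrite (hside_FTC (F := F))//; last 2 first.
  by move=> t /on_bd_bottom /fc.
  by move=> t /on_bd_bottom /Ff.
rewrite (vside_FTC (F := F))//; last 2 first.
  by move=> t /on_bd_right /fc.
  by move=> t /on_bd_right /Ff.
rewrite (hside_FTC (F := F))//; last 2 first.
  by move=> t /on_bd_top /fc.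
  by move=> t /on_bd_top /Ff.
rewrite (vside_FTC (F := F))//; last 2 first.
  by move=> t /on_bd_left /fc.
  by move=> t /on_bd_left /Ff.
by ring.
Qed.

Section continuous_sides.
Variable f : R[i] -> R[i].
Hypothesis fc : forall z, on_boundary x1 x2 y1 y2 z ->
  {for z, continuous (f : R[i]^o -> R[i]^o)}.

Lemma continuous_bottom t : x1 <= t <= x2 ->
  {for t, continuous (fun s : R => f (Complex s y1) : R[i]^o)}.
Proof. by move=> tx; exact: continuous_hline (fc (on_bd_bottom tx)). Qed.

Lemma continuous_top t : x1 <= t <= x2 ->
  {for t, continuous (fun s : R => f (Complex s y2) : R[i]^o)}.
Proof. by move=> tx; exact: continuous_hline (fc (on_bd_top tx)). Qed.

Lemma continuous_left t : y1 <= t <= y2 ->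
  {for t, continuous (fun s : R => f (Complex x1 s) : R[i]^o)}.
Proof. by move=> ty; exact: continuous_vline (fc (on_bd_left ty)). Qed.

Lemma continuous_right t : y1 <= t <= y2 ->
  {for t, continuous (fun s : R => f (Complex x2 s) : R[i]^o)}.
Proof. by move=> ty; exact: continuous_vline (fc (on_bd_right ty)). Qed.

End continuous_sides.

Lemma rect_lin f g (al be : R[i]) :
  (forall z, on_boundary x1 x2 y1 y2 z -> {for z, continuous (f : R[i]^o -> R[i]^o)}) ->
  (forall z, on_boundary x1 x2 y1 y2 z -> {for z, continuous (g : R[i]^o -> R[i]^o)}) ->
  rect_integral (fun z => al * f z + be * g z) x1 x2 y1 y2 =
  al * rect_integral f x1 x2 y1 y2 + be * rect_integral g x1 x2 y1 y2.
Proof.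
move=> fc gc; rewrite /rect_integral /hside /vside.
rewrite (cint_lin al be (continuous_bottom fc) (continuous_bottom gc)).
rewrite (cint_lin al be (continuous_right fc) (continuous_right gc)).
rewrite (cint_lin al be (continuous_top fc) (continuous_top gc)).
rewrite (cint_lin al be (continuous_left fc) (continuous_left gc)).
by ring.
Qed.

Lemma cabs_rect_le f :
  (forall z, on_boundary x1 x2 y1 y2 z -> {for z, continuous (f : R[i]^o -> R[i]^o)}) ->
  cabs (rect_integral f x1 x2 y1 y2) <=
  \int[mu]_(t in `[x1, x2]) cabs (f (Complex t y1)) +
  \int[mu]_(t in `[y1, y2]) cabs (f (Complex x2 t)) +
  \int[mu]_(t in `[x1, x2]) cabs (f (Complex t y2)) +
  \int[mu]_(t in `[y1, y2]) cabs (f (Complex x1 t)).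
Proof.
move=> fc; rewrite /rect_integral.
have ci : cabs ('i%C : R[i]) = 1 by rewrite /cabs/= expr0n/= expr1n add0r sqrtr1.
apply: le_trans (cabsD _ _) _; apply: lerD; last first.
  rewrite cabsN cabsM ci mul1r; exact: cabs_cint_le (continuous_left fc).
apply: le_trans (cabsD _ _) _; apply: lerD; last first.
  rewrite cabsN; exact: cabs_cint_le (continuous_top fc).
apply: le_trans (cabsD _ _) _; apply: lerD; last first.
  rewrite cabsM ci mul1r; exact: cabs_cint_le (continuous_right fc).
exact: cabs_cint_le (continuous_bottom fc).
Qed.

Lemma cabs_rect_le_sup f (M : R) :
  (forall z, on_boundary x1 x2 y1 y2 z -> {for z, continuous (f : R[i]^o -> R[i]^o)}) ->
  (forall z, on_boundary x1 x2 y1 y2 z -> cabs (f z) <= M) ->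
  cabs (rect_integral f x1 x2 y1 y2) <= 2 * M * ((x2 - x1) + (y2 - y1)).
Proof.
move=> fc fM; apply: le_trans (cabs_rect_le fc) _.
have side (h : R -> R[i]) a b : a <= b ->
    (forall t, a <= t <= b -> {for t, continuous (h : R -> R[i]^o)}) ->
    (forall t, a <= t <= b -> cabs (h t) <= M) ->
    \int[mu]_(t in `[a, b]) cabs (h t) <= M * (b - a).
  move=> ab hc hM.
  rewrite -(_ : \int[mu]_(t in `[a, b]) M = M * (b - a)); last first.
    rewrite Rintegral_cst//= lebesgue_measure_itv/= lte_fin.
    by case: ltgtP ab => // -> _; rewrite subrr.
  apply: le_Rintegral => //.
  - by apply: segment_integrable => t /hc /continuous_cabs_comp.
  - by apply: segment_integrable => t _; exact: cst_continuous.
have -> : 2 * M * ((x2 - x1) + (y2 - y1)) =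
   M * (x2 - x1) + M * (y2 - y1) + M * (x2 - x1) + M * (y2 - y1) by ring.
apply: lerD; [apply: lerD; [apply: lerD|]|].
- by apply: side (continuous_bottom fc) _ => // t tx; exact: fM (on_bd_bottom tx).
- by apply: side (continuous_right fc) _ => // t ty; exact: fM (on_bd_right ty).
- by apply: side (continuous_top fc) _ => // t tx; exact: fM (on_bd_top tx).
- by apply: side (continuous_left fc) _ => // t ty; exact: fM (on_bd_left ty).
Qed.

End boundary.

Lemma rect_splitx f x1 x2 y1 y2 c : x1 <= c <= x2 ->
  (forall t, x1 <= t <= x2 -> {for Complex t y1, continuous (f : R[i]^o -> R[i]^o)}) ->
  (forall t, x1 <= t <= x2 -> {for Complex t y2, continuous (f : R[i]^o -> R[i]^o)}) ->
  rect_integral f x1 x2 y1 y2 = rect_integral f x1 c y1 y2 + rect_integral f c x2 y1 y2.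
Proof.
move=> cx f1 f2; rewrite /rect_integral /hside (cint_add cx); last first.
  by move=> t /f1 /continuous_hline.
rewrite [cint _ x1 x2](cint_add cx); last by move=> t /f2 /continuous_hline.
by ring.
Qed.

Lemma rect_splity f x1 x2 y1 y2 c : y1 <= c <= y2 ->
  (forall t, y1 <= t <= y2 -> {for Complex x1 t, continuous (f : R[i]^o -> R[i]^o)}) ->
  (forall t, y1 <= t <= y2 -> {for Complex x2 t, continuous (f : R[i]^o -> R[i]^o)}) ->
  rect_integral f x1 x2 y1 y2 = rect_integral f x1 x2 y1 c + rect_integral f x1 x2 c y2.
Proof.
move=> cy f1 f2; rewrite /rect_integral /vside (cint_add cy); last first.
  by move=> t /f2 /continuous_vline.
rewrite [cint _ y1 y2](cint_add cy); last by move=> t /f1 /continuous_vline.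
by ring.
Qed.

End contour.

(** * Goursat's theorem *)
Section goursat.
Context {R : realType}.
Implicit Types (f g F : R[i] -> R[i]) (a b c t x y : R).

(** Nested rectangles: if P failed for the whole rectangle it would fail for one
    of the quarters, then for a quarter of that one, and so on; the
    lower left corners converge to a point (X, Y) lying in all these rectangles,
    against the local hypothesis at (X, Y).  The rectangle with corner (x, y)
    and scale d has the fixed shape d w by d h. *)
Lemma bisection (P : R -> R -> R -> Prop) x0 y0 w h : 0 < w -> 0 < h ->
  (forall x y d, 0 < d ->
    P x y (d / 2) -> P (x + d / 2 * w) y (d / 2) ->
    P x (y + d / 2 * h) (d / 2) -> P (x + d / 2 * w) (y + d / 2 * h) (d / 2) ->
    P x y d) ->
  (forall X Y, x0 <= X <= x0 + w -> y0 <= Y <= y0 + h ->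
    exists2 e, 0 < e & forall x y d, 0 < d < e ->
      x <= X <= x + d * w -> y <= Y <= y + d * h -> P x y d) ->
  P x0 y0 1.
Proof.
move=> w0 h0 Pstep Ploc; apply: contrapT => nP.
have step (s : (R * R) * R) : exists s' : (R * R) * R, 0 < s.2 -> ~ P s.1.1 s.1.2 s.2 ->
    [/\ ~ P s'.1.1 s'.1.2 s'.2, s'.2 = s.2 / 2,
      s.1.1 <= s'.1.1 <= s.1.1 + s.2 / 2 * w & s.1.2 <= s'.1.2 <= s.1.2 + s.2 / 2 * h].
  case: s => [[x y] d]/=.
  have [d0|d0] := ltP 0 d; last by exists ((x, y), d).
  have dw : 0 <= d / 2 * w by rewrite mulr_ge0 ?divr_ge0 ?ltW.
  have dh : 0 <= d / 2 * h by rewrite mulr_ge0 ?divr_ge0 ?ltW.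
  have [P1|P1] := pselect (P x y (d / 2)); last first.
    by exists ((x, y), d / 2) => _ _; split => //=; rewrite lexx lerDl.
  have [P2|P2] := pselect (P (x + d / 2 * w) y (d / 2)); last first.
    by exists ((x + d / 2 * w, y), d / 2) => _ _; split => //=; rewrite lexx lerDl ?dw ?dh.
  have [P3|P3] := pselect (P x (y + d / 2 * h) (d / 2)); last first.
    by exists ((x, y + d / 2 * h), d / 2) => _ _; split => //=; rewrite lexx lerDl ?dw ?dh.
  exists ((x + d / 2 * w, y + d / 2 * h), d / 2) => _ nPd; split => //=.
  - by move=> P4; exact: nPd (Pstep _ _ _ d0 P1 P2 P3 P4).
  - by rewrite lexx lerDl dw.
  - by rewrite lexx lerDl dh.
have [next nextP] := choice step.
pose s n := iter n next ((x0, y0), 1).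
have s2 n : (s n).2 = 2^-1 ^+ n /\ ~ P (s n).1.1 (s n).1.2 (s n).2.
  elim: n => [|n [IH1 IH2]]; first by rewrite /s /= expr0.
  have sn0 : 0 < (s n).2 by rewrite IH1 exprn_gt0.
  by have [A1 A2 _ _] := nextP _ sn0 IH2; rewrite /s iterS A2 -/(s n) IH1 -exprSr; split => //;
    rewrite exprSr -IH1 -A2.
have d0 n : 0 < 2^-1 ^+ n :> R by rewrite exprn_gt0.
have sx n : (s n).1.1 <= (s n.+1).1.1 /\
    (s n.+1).1.1 + 2^-1 ^+ n.+1 * w <= (s n).1.1 + 2^-1 ^+ n * w.
  have [IH1 IH2] := s2 n.
  have sn0 : 0 < (s n).2 by rewrite IH1.
  have [_ _ /andP[A1 A2] _] := nextP _ sn0 IH2; split => //.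
  by move: A2; rewrite IH1 exprS /s iterS -/(s n); lra.
have sy n : (s n).1.2 <= (s n.+1).1.2 /\
    (s n.+1).1.2 + 2^-1 ^+ n.+1 * h <= (s n).1.2 + 2^-1 ^+ n * h.
  have [IH1 IH2] := s2 n.
  have sn0 : 0 < (s n).2 by rewrite IH1.
  have [_ _ _ /andP[A1 A2]] := nextP _ sn0 IH2; split => //.
  by move: A2; rewrite IH1 exprS /s iterS -/(s n); lra.
(* Lower ends increase and upper ends decrease, so the supremum of the lower
   ends lies in every interval. *)
have nested (u : nat -> R) (k : R) : 0 < k ->
    (forall n, u n <= u n.+1 /\ u n.+1 + 2^-1 ^+ n.+1 * k <= u n + 2^-1 ^+ n * k) ->
    exists X, forall n, u n <= X <= u n + 2^-1 ^+ n * k.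
  move=> k0 uk.
  have up n m : u n <= u (n + m)%N /\ u (n + m)%N + 2^-1 ^+ (n + m) * k <= u n + 2^-1 ^+ n * k.
    elim: m => [|m [IH1 IH2]]; first by rewrite addn0.
    have [A1 A2] := uk (n + m)%N; rewrite addnS; split; first exact: le_trans A1.
    exact: le_trans IH2.
  have ub n m : u m <= u n + 2^-1 ^+ n * k.
    have p j : 0 <= 2^-1 ^+ j * k :> R by rewrite mulr_ge0// ltW.
    have [nm|/ltnW mn] := leqP n m.
      have [_ +] := up n (m - n)%N; rewrite subnKC//; apply: le_trans.
      by rewrite lerDl.
    have [+ _] := up m (n - m)%N; rewrite subnKC// => /le_trans; apply.
    by rewrite lerDl.
  have hs : has_sup (range u).
    split; first by exists (u 0%N), 0%N.
    by exists (u 0%N + 2^-1 ^+ 0 * k) => _ [m _ <-]; exact: ub.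
  exists (sup (range u)) => n; apply/andP; split.
    by apply: sup_upper_bound => //; exists n.
  by apply: ge_sup; [case: hs|move=> _ [m _ <-]; exact: ub].
have [X XP] := nested (fun n => (s n).1.1) w w0 sx.
have [Y YP] := nested (fun n => (s n).1.2) h h0 sy.
have X0 := XP 0%N; have Y0 := YP 0%N.
rewrite /s/= expr0 mul1r in X0; rewrite /s/= expr0 mul1r in Y0.
have [e e0 Pe] := Ploc X Y X0 Y0.
have [n ne] : exists n, 2^-1 ^+ n < e.
  have /cvgrPdist_lt /(_ e e0) [n _ /(_ n (leqnn n)) np] :
    (fun n => 2^-1 ^+ n : R) @ \oo --> (0 : R).
    by apply: cvg_expr; rewrite ger0_norm ?invr_ge0// invf_lt1// ltr1n.
  by exists n; move: np; rewrite /= sub0r normrN ger0_norm// ltW.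
have [E nPn] := s2 n; apply: nPn; rewrite E; apply: Pe => //.
by rewrite d0.
Qed.

(** The estimate |contour integral| <= e d^2 passes from quarters to the whole,
    because both sides are additive.  It holds near every point: the affine
    part of f has a primitive, and the remainder is at most e' d on a contour
    of length O(d). *)
Lemma goursat f x1 x2 y1 y2 : x1 < x2 -> y1 < y2 ->
  (forall z, on_rect x1 x2 y1 y2 z -> exists l, cderiv f z l) ->
  rect_integral f x1 x2 y1 y2 = 0.
Proof.
move=> x12 y12 fd.
have fc z : on_rect x1 x2 y1 y2 z -> {for z, continuous (f : R[i]^o -> R[i]^o)}.
  by move=> /fd[l]; exact: cderiv_continuous.
pose w := x2 - x1; pose h := y2 - y1.
have w0 : 0 < w by rewrite subr_gt0.
have h0 : 0 < h by rewrite subr_gt0.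
apply/eqP; rewrite -cabs_eq0 eq_le cabs_ge0 andbT; apply/ler_addgt0Pr => e e0.
rewrite add0r.
pose P x y d := x1 <= x -> x + d * w <= x2 -> y1 <= y -> y + d * h <= y2 ->
  cabs (rect_integral f x (x + d * w) y (y + d * h)) <= e * d ^+ 2.
have -> : x2 = x1 + 1 * w by rewrite /w; ring.
have -> : y2 = y1 + 1 * h by rewrite /h; ring.
suff : P x1 y1 1.
  rewrite /P expr1n mulr1; apply => //; rewrite /w /h; lra.
apply: (bisection w0 h0).
- move=> x y d d0 P1 P2 P3 P4 xx1 xx2 yy1 yy2.
  have dw : 0 < d / 2 * w by rewrite mulr_gt0 ?divr_gt0.
  have dh : 0 < d / 2 * h by rewrite mulr_gt0 ?divr_gt0.
  have {P1 P2 P3 P4} : [/\ cabs (rect_integral f x (x + d / 2 * w) y (y + d / 2 * h)) <= e * (d /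
    2) ^+ 2,
    cabs (rect_integral f (x + d / 2 * w) (x + d * w) y (y + d / 2 * h)) <= e * (d / 2) ^+ 2,
    cabs (rect_integral f x (x + d / 2 * w) (y + d / 2 * h) (y + d * h)) <= e * (d / 2) ^+ 2 &
    cabs (rect_integral f (x + d / 2 * w) (x + d * w) (y + d / 2 * h) (y + d * h)) <= e * (d / 2)
      ^+ 2].
    have Ew : x + d * w = x + d / 2 * w + d / 2 * w by field.
    have Eh : y + d * h = y + d / 2 * h + d / 2 * h by field.
    rewrite Ew in xx2 *; rewrite Eh in yy2 *.
    have x2' : x + d / 2 * w <= x2 by apply: le_trans xx2; rewrite lerDl ltW.
    have y2' : y + d / 2 * h <= y2 by apply: le_trans yy2; rewrite lerDl ltW.
    have x1' : x1 <= x + d / 2 * w by apply: le_trans xx1 _; rewrite lerDl ltW.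
    have y1' : y1 <= y + d / 2 * h by apply: le_trans yy1 _; rewrite lerDl ltW.
    by split; [exact: P1|exact: P2|exact: P3|exact: P4].
  move=> [P1 P2 P3 P4].
  have Ew : x + d / 2 * w + d / 2 * w = x + d * w by field.
  have Eh : y + d / 2 * h + d / 2 * h = y + d * h by field.
  have fc' u v : x <= u <= x + d * w -> y <= v <= y + d * h ->
      {for Complex u v, continuous (f : R[i]^o -> R[i]^o)}.
    move=> /andP[u1 u2] /andP[v1 v2]; apply: fc; rewrite /on_rect/=.
    by rewrite (le_trans xx1 u1) (le_trans u2 xx2) (le_trans yy1 v1) (le_trans v2 yy2).
  rewrite (rect_splitx (c := x + d / 2 * w)); last 3 first.
  - by lra.
  - by move=> t tt; apply: fc' => //; lra.
  - by move=> t tt; apply: fc' => //; lra.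
  rewrite (rect_splity (c := y + d / 2 * h)); last 3 first.
  - by lra.
  - by move=> t tt; apply: fc' => //; lra.
  - by move=> t tt; apply: fc' => //; lra.
  rewrite (rect_splity (y1 := y) (c := y + d / 2 * h) (x2 := x + d * w)); last 3 first.
  - by lra.
  - by move=> t tt; apply: fc' => //; lra.
  - by move=> t tt; apply: fc' => //; lra.
  apply: le_trans (cabsD _ _) _.
  have B1 := cabsD (rect_integral f x (x + d / 2 * w) y (y + d / 2 * h))
              (rect_integral f x (x + d / 2 * w) (y + d / 2 * h) (y + d * h)).
  have B2 := cabsD (rect_integral f (x + d / 2 * w) (x + d * w) y (y + d / 2 * h))
              (rect_integral f (x + d / 2 * w) (x + d * w) (y + d / 2 * h) (y + d * h)).
  have Ed : e * d ^+ 2 = e * (d / 2) ^+ 2 + e * (d / 2) ^+ 2 + (e * (d / 2) ^+ 2 + e * (d / 2) ^+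
    2).
    by field.
  rewrite Ed; apply: lerD; [apply: le_trans B1 _|apply: le_trans B2 _]; exact: lerD.
- move=> X Y XX YY; pose z := Complex X Y.
  have [l fl] : exists l, cderiv f z l.
    by apply: fd; rewrite /on_rect/=; move: XX YY; rewrite /w /h; lra.
  pose K := w + h.
  have K0 : 0 < K by rewrite addr_gt0.
  have e'0 : 0 < e / (2 * K ^+ 2) by rewrite divr_gt0// mulr_gt0// exprn_gt0.
  have [d0 d00 fz] := fl _ e'0.
  exists (d0 / K); first by rewrite divr_gt0.
  move=> x y d /andP[dpos]; rewrite ltr_pdivlMr// => dd xX yY xx1 xx2 yy1 yy2.
  have dw : 0 < d * w by rewrite mulr_gt0.
  have dh : 0 < d * h by rewrite mulr_gt0.
  have xle : x <= x + d * w by lra.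
  have yle : y <= y + d * h by lra.
  (* A is the affine part of f at z, and AF a primitive of A. *)
  pose A (u : R[i]) : R[i] := f z + l * (u - z).
  pose AF (u : R[i]) : R[i] := f z * u + l * (u * u / 2 - z * u).
  have AFd u : cderiv AF u (A u).
    have -> : A u = (0 * u + f z * 1) +
       (0 * (u * u / 2 - z * u) + l * (((1 * u + u * 1) * 2^-1 + u * u * 0) - (0 * u + z * 1))).
      by rewrite /A; field.
    apply: (cderivD (f := fun u => f z * u) (g := fun u => l * (u * u / 2 - z * u))).
      by apply: (cderivM (f := fun=> f z) (g := id)); [exact: cderiv_cst|exact: cderiv_id].
    apply: (cderivM (f := fun=> l) (g := fun u => u * u / 2 - z * u)); first exact: cderiv_cst.
    apply: (cderivB (f := fun u => u * u / 2) (g := fun u => z * u)).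
      apply: (cderivM (f := fun u => u * u) (g := fun=> 2^-1)); last exact: cderiv_cst.
      by apply: (cderivM (f := id) (g := id)); exact: cderiv_id.
    by apply: (cderivM (f := fun=> z) (g := id)); [exact: cderiv_cst|exact: cderiv_id].
  have Ac u : {for u, continuous (A : R[i]^o -> R[i]^o)}.
    have : cderiv A u (0 + (0 * (u - z) + l * (1 - 0))).
      apply: (cderivD (f := fun=> f z) (g := fun u => l * (u - z))); first exact: cderiv_cst.
      apply: (cderivM (f := fun=> l) (g := fun u => u - z)); first exact: cderiv_cst.
      by apply: (cderivB (f := id) (g := fun=> z)); [exact: cderiv_id|exact: cderiv_cst].
    exact: cderiv_continuous.
  have fcb u : on_boundary x (x + d * w) y (y + d * h) u -> {for u, continuous (f : R[i]^o ->
    R[i]^o)}.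
    move=> /andP[/andP[u1 u2] _]; apply: fc; rewrite /on_rect; lra.
  have -> : rect_integral f x (x + d * w) y (y + d * h) =
      rect_integral (fun u => 1 * f u + -1 * A u) x (x + d * w) y (y + d * h).
    rewrite (rect_lin xle yle 1 (-1) fcb (fun u _ => Ac u)).
    rewrite (rect_FTC xle yle (fun u _ => Ac u) (fun u _ => AFd u)).
    by rewrite mulr0 addr0 mul1r.
  apply: le_trans (cabs_rect_le_sup (M := e / (2 * K ^+ 2) * (d * K)) xle yle _ _) _.
  + move=> u /fcb uc.
    have H1 := @continuous_mulc R R[i]^o f 1 u uc.
    have H2 := @continuous_mulc R R[i]^o A (-1) u (Ac u).
    exact: continuous_add H1 H2.
  + move=> u /andP[/andP[u1 u2] _].
    have uz : cabs (u - z) <= d * K.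
      apply: le_trans (cabs_le_ReIm _) _.
      rewrite /K mulrDr; apply: lerD.
        by rewrite raddfB/= ler_norml; lra.
      by rewrite raddfB/= ler_norml; lra.
    have := fz u (le_lt_trans uz dd).
    have -> : f u - f z - l * (u - z) = 1 * f u + -1 * A u by rewrite /A; ring.
    move=> /le_trans; apply; rewrite ler_pM2l//.
  + have -> : x + d * w - x + (y + d * h - y) = d * K by rewrite /K; ring.
    rewrite le_eqVlt; apply/orP; left; apply/eqP; field.
    by rewrite gt_eqF.
Qed.

End goursat.

(** * Cauchy's formula for the derivative *)
Section cauchy.
Context {R : realType}.
Notation mu := (@lebesgue_measure R).
Implicit Types (f g F : R[i] -> R[i]) (a z : R[i]).

Lemma on_boundary_rect x1 x2 y1 y2 (z : R[i]) : on_boundary x1 x2 y1 y2 z -> on_rect x1 x2 y1 y2 z.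
Proof. by case/andP. Qed.

(** The outer rectangle is cut into two vertical strips, two horizontal pieces
    and the inner rectangle; Goursat's theorem disposes of the first four. *)
Lemma rect_annulus f (x1 x2 y1 y2 u1 u2 v1 v2 : R) :
  x1 < u1 -> u1 < u2 -> u2 < x2 -> y1 < v1 -> v1 < v2 -> v2 < y2 ->
  (forall z, on_rect x1 x2 y1 y2 z ->
     ~~ ((u1 < complex.Re z < u2) && (v1 < complex.Im z < v2)) -> exists l, cderiv f z l) ->
  rect_integral f x1 x2 y1 y2 = rect_integral f u1 u2 v1 v2.
Proof.
move=> xu uu ux yv vv vy fd.
have fd' s t : x1 <= s <= x2 -> y1 <= t <= y2 -> [|| s <= u1, u2 <= s, t <= v1 | v2 <= t] ->
    exists l, cderiv f (Complex s t) l.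
  move=> sx ty st; apply: fd; first by rewrite /on_rect/= sx ty.
  by rewrite /= !negb_and -!leNgt -orbA.
have fc s t : x1 <= s <= x2 -> y1 <= t <= y2 -> [|| s <= u1, u2 <= s, t <= v1 | v2 <= t] ->
    {for Complex s t, continuous (f : R[i]^o -> R[i]^o)}.
  by move=> sx ty /(fd' _ _ sx ty)[l]; exact: cderiv_continuous.
have xu1 : x1 <= u1 <= x2 by rewrite (ltW xu) (ltW (lt_trans uu ux)).
have xu2 : x1 <= u2 <= x2 by rewrite (ltW ux) (ltW (lt_trans xu uu)).
have yv1 : y1 <= v1 <= y2 by rewrite (ltW yv) (ltW (lt_trans vv vy)).
have yv2 : y1 <= v2 <= y2 by rewrite (ltW vy) (ltW (lt_trans yv vv)).
have yy1 : y1 <= y1 <= y2 by rewrite lexx (ltW (lt_trans yv (lt_trans vv vy))).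
have yy2 : y1 <= y2 <= y2 by rewrite lexx (ltW (lt_trans yv (lt_trans vv vy))).
have ux2 t : u1 <= t <= x2 -> x1 <= t <= x2.
  by move=> /andP[t1 ->]; rewrite (le_trans (ltW xu) t1).
have vy2 t : v1 <= t <= y2 -> y1 <= t <= y2.
  by move=> /andP[t1 ->]; rewrite (le_trans (ltW yv) t1).
rewrite (@rect_splitx _ f x1 x2 y1 y2 u1)//; last 2 first.
  by move=> t tx; apply: fc => //; rewrite (ltW yv) !orbT.
  by move=> t tx; apply: fc => //; rewrite (ltW vy) !orbT.
rewrite [X in X + _](goursat xu (lt_trans yv (lt_trans vv vy))) ?add0r; last first.
  move=> [s t] /andP[/= /andP[s1 s2] ty]; apply: fd' => //; last by rewrite s2.
  by rewrite s1 (le_trans s2)// (ltW (lt_trans uu ux)).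
rewrite (@rect_splitx _ f u1 x2 y1 y2 u2) ?(ltW ux) ?(ltW uu)//; last 2 first.
  by move=> t tx; apply: fc => //; [exact: ux2|rewrite (ltW yv) !orbT].
  by move=> t tx; apply: fc => //; [exact: ux2|rewrite (ltW vy) !orbT].
rewrite [X in _ + X](goursat ux (lt_trans yv (lt_trans vv vy))) ?addr0; last first.
  move=> [s t] /andP[/= /andP[s1 s2] ty]; apply: fd' => //; last by rewrite s1 orbT.
  by rewrite s2 (le_trans _ s1)// (ltW (lt_trans xu uu)).
rewrite (@rect_splity _ f u1 u2 y1 y2 v1)//; last 2 first.
  by move=> t tx; apply: fc => //; rewrite lexx.
  by move=> t tx; apply: fc => //; rewrite lexx orbT.
rewrite [X in X + _](goursat uu yv) ?add0r; last first.
  move=> [s t] /andP[/= /andP[s1 s2] /andP[t1 t2]]; apply: fd'.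
  - by rewrite (le_trans (ltW xu) s1) (le_trans s2 (ltW ux)).
  - by rewrite t1 (le_trans t2)// (ltW (lt_trans vv vy)).
  - by rewrite t2 !orbT.
rewrite (@rect_splity _ f u1 u2 v1 y2 v2) ?(ltW vy) ?(ltW vv)//; last 2 first.
  by move=> t tx; apply: fc => //; [exact: vy2|rewrite lexx].
  by move=> t tx; apply: fc => //; [exact: vy2|rewrite lexx orbT].
rewrite [X in _ + X](goursat uu vy) ?addr0// => -[s t].
move=> /andP[/= /andP[s1 s2] /andP[t1 t2]]; apply: fd'.
- by rewrite (le_trans (ltW xu) s1) (le_trans s2 (ltW ux)).
- by rewrite t2 (le_trans _ t1)// (ltW (lt_trans yv vv)).
- by rewrite t1 !orbT.
Qed.

Lemma cderiv_inv a z : z != a -> cderiv (fun w => (w - a)^-1) z (- 1 / (z - a) ^+ 2).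
Proof.
move=> za.
rewrite -[in - 1](subr0 1); apply: (cderivV (f := fun w => w - a)).
  by rewrite subr_eq0.
by apply: (cderivB (f := id) (g := fun=> a)); [exact: cderiv_id|exact: cderiv_cst].
Qed.

Lemma square_boundary_dist a (s : R) z : 0 < s ->
  on_boundary (complex.Re a - s) (complex.Re a + s) (complex.Im a - s) (complex.Im a + s) z ->
  s <= cabs (z - a) <= 2 * s.
Proof.
move=> s0 /andP[/andP[xs ys] xys].
have ReB : complex.Re (z - a) = complex.Re z - complex.Re a by rewrite raddfB.
have ImB : complex.Im (z - a) = complex.Im z - complex.Im a by rewrite raddfB.
apply/andP; split.
- move: xys => /or4P[] /eqP E.
  + by apply: le_trans _ (ler_Re_cabs _); rewrite ReB E ler0_norm; lra.
  + by apply: le_trans _ (ler_Re_cabs _); rewrite ReB E ger0_norm; lra.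
  + by apply: le_trans _ (ler_Im_cabs _); rewrite ImB E ler0_norm; lra.
  + by apply: le_trans _ (ler_Im_cabs _); rewrite ImB E ger0_norm; lra.
- apply: le_trans (cabs_le_ReIm _) _; rewrite ReB ImB mulr_natl mulr2n.
  by apply: lerD; rewrite ler_norml; lra.
Qed.

Definition rect_winding a x1 x2 y1 y2 := rect_integral (fun z => (z - a)^-1) x1 x2 y1 y2.

(** The exact value is 2 pi i, but a lower bound is enough and is elementary:
    each side contributes to the imaginary part the integral of
    s / (k^2 + s^2) >= 1 / (2s) over a segment of length 2s. *)
Lemma rect_winding_square a (s : R) : 0 < s ->
  4 <= cabs (rect_winding a (complex.Re a - s) (complex.Re a + s) (complex.Im a - s) (complex.Im
    a + s)).
Proof.
move=> s0; apply: le_trans _ (ler_Im_cabs _); apply: le_trans _ (ler_norm _).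
set x1 := complex.Re a - s; set x2 := complex.Re a + s.
set y1 := complex.Im a - s; set y2 := complex.Im a + s.
have x12 : x1 <= x2 by rewrite /x1 /x2; lra.
have y12 : y1 <= y2 by rewrite /y1 /y2; lra.
have fc z : on_boundary x1 x2 y1 y2 z ->
    {for z, continuous ((fun z => (z - a)^-1) : R[i]^o -> R[i]^o)}.
  move=> /(square_boundary_dist s0)/andP[+ _] => sz.
  apply: cderiv_continuous; apply: cderiv_inv.
  by rewrite -subr_eq0 -cabs_gt0 (lt_le_trans s0).
have side (e : R) (P : R -> R) c d : d - c = 2 * s ->
    (forall t, c <= t <= d -> {for t, continuous P}) ->
    (forall t, c <= t <= d -> (2 * s)^-1 <= e * P t) ->
    1 <= e * \int[mu]_(t in `[c, d]) P t.
  move=> E Pc PM.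
  rewrite -(_ : \int[mu]_(t in `[c, d]) (2 * s)^-1 = 1); last first.
    rewrite Rintegral_cst//= lebesgue_measure_itv/= lte_fin.
    have -> : c < d by lra.
    by rewrite /= E mulVf// gt_eqF// mulr_gt0.
  rewrite -RintegralZl//; last exact: segment_integrable.
  apply: le_Rintegral => //.
  - by apply: segment_integrable => t _; exact: cst_continuous.
  - apply: segment_integrable => t /Pc tc.
    by apply: continuousM => //; exact: cst_continuous.
have ReV z : complex.Re (z - a)^-1 =
    (complex.Re z - complex.Re a) / ((complex.Re z - complex.Re a) ^+ 2 + (complex.Im z -
      complex.Im a) ^+ 2).
  by case: (a) z => ? ? [].
have ImV z : complex.Im (z - a)^-1 =
    - ((complex.Im z - complex.Im a) / ((complex.Re z - complex.Re a) ^+ 2 + (complex.Im z -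
      complex.Im a) ^+ 2)).
  by case: (a) z => ? ? [].
have kernel (k : R) : - s <= k <= s -> (2 * s)^-1 <= s / (k ^+ 2 + s ^+ 2).
  move=> /andP[k1 k2].
  have q0 : 0 < k ^+ 2 + s ^+ 2 by rewrite ltr_wpDl ?sqr_ge0// exprn_gt0.
  rewrite ler_pdivlMr// mulrC ler_pdivrMr ?mulr_gt0//; nra.
have E1 : x2 - x1 = 2 * s by rewrite /x1 /x2; ring.
have E2 : y2 - y1 = 2 * s by rewrite /y1 /y2; ring.
have I1 : 1 <= 1 * \int[mu]_(t in `[x1, x2]) complex.Im (Complex t y1 - a)^-1.
  apply: side => //; first by move=> t /(continuous_bottom y12 fc) /continuous_Im_comp.
  move=> t tx; rewrite mul1r ImV/= -mulNr.
  have -> : y1 - complex.Im a = - s by rewrite /y1; ring.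
  by rewrite opprK sqrrN; apply: kernel; move: tx; rewrite /x1 /x2; lra.
have I2 : 1 <= 1 * \int[mu]_(t in `[y1, y2]) complex.Re (Complex x2 t - a)^-1.
  apply: side => //; first by move=> t /(continuous_right x12 fc) /continuous_Re_comp.
  move=> t ty; rewrite mul1r ReV/=.
  have -> : x2 - complex.Re a = s by rewrite /x2; ring.
  by rewrite [s ^+ 2 + _]addrC; apply: kernel; move: ty; rewrite /y1 /y2; lra.
have I3 : 1 <= -1 * \int[mu]_(t in `[x1, x2]) complex.Im (Complex t y2 - a)^-1.
  apply: side => //; first by move=> t /(continuous_top y12 fc) /continuous_Im_comp.
  move=> t tx; rewrite mulN1r ImV/= opprK.
  have -> : y2 - complex.Im a = s by rewrite /y2; ring.
  by apply: kernel; move: tx; rewrite /x1 /x2; lra.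
have I4 : 1 <= -1 * \int[mu]_(t in `[y1, y2]) complex.Re (Complex x1 t - a)^-1.
  apply: side => //; first by move=> t /(continuous_left x12 fc) /continuous_Re_comp.
  move=> t ty; rewrite mulN1r ReV/= -mulNr.
  have -> : x1 - complex.Re a = - s by rewrite /x1; ring.
  by rewrite opprK sqrrN [s ^+ 2 + _]addrC; apply: kernel; move: ty; rewrite /y1 /y2; lra.
rewrite /rect_winding /rect_integral /vside /hside.
have expand (p q u v : R[i]) : complex.Im (p + 'i%C * q - u - 'i%C * v) =
    complex.Im p + complex.Re q - complex.Im u - complex.Re v.
  by case: p q u v => ? ? [? ?] [? ?] [? ?] /=; ring.
rewrite expand/=.
have sum4 (p q u v : R) : 1 <= 1 * p -> 1 <= 1 * q -> 1 <= -1 * u -> 1 <= -1 * v ->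
  4 <= p + q - u - v by lra.
exact: sum4.
Qed.

Section formula.
Variables (f : R[i] -> R[i]) (a : R[i]) (x1 x2 y1 y2 : R).
Hypotheses (ax : x1 < complex.Re a < x2) (ay : y1 < complex.Im a < y2).

Lemma interior_not_boundary z : on_boundary x1 x2 y1 y2 z -> z != a.
Proof.
move=> /andP[_ H]; apply/eqP => za; move: H; rewrite za.
by case/or4P => /eqP E; move: ax ay; rewrite E ltxx ?andbF.
Qed.

Lemma small_square : exists2 s0, 0 < s0 & forall s, 0 < s < s0 ->
  [/\ x1 < complex.Re a - s, complex.Re a + s < x2, y1 < complex.Im a - s & complex.Im a + s < y2].
Proof.
case/andP: ax => a1 a2; case/andP: ay => b1 b2.
exists (Num.min (Num.min (complex.Re a - x1) (x2 - complex.Re a))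
                (Num.min (complex.Im a - y1) (y2 - complex.Im a))).
  by rewrite !lt_min !subr_gt0 a1 a2 b1 b2.
by move=> s /andP[s0]; rewrite !lt_min => /andP[/andP[? ?] /andP[? ?]]; split; lra.
Qed.

Let square_center s z : 0 < s ->
  ~~ ((complex.Re a - s < complex.Re z < complex.Re a + s) &&
      (complex.Im a - s < complex.Im z < complex.Im a + s)) -> z != a.
Proof.
move=> s0; apply: contraNneq => ->.
by rewrite !ltrBlDr !ltrDl s0.
Qed.

Lemma rect_winding_ge4 : 4 <= cabs (rect_winding a x1 x2 y1 y2).
Proof.
have [s0 s00 sP] := small_square.
have s2 : 0 < s0 / 2 < s0 by lra.
have [h1 h2 h3 h4] := sP _ s2.
have s20 : 0 < s0 / 2 by case/andP: s2.
rewrite /rect_winding (@rect_annulus _ _ _ _ _ (complex.Re a - s0 / 2) (complex.Re a + s0 / 2)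
   (complex.Im a - s0 / 2) (complex.Im a + s0 / 2))//.
- exact: rect_winding_square.
- lra.
- lra.
- move=> z _ /(square_center s20) za.
  by exists (- 1 / (z - a) ^+ 2); exact: cderiv_inv.
Qed.

Hypothesis fd : forall z, on_rect x1 x2 y1 y2 z -> exists l, cderiv f z l.

(** The function h = (f(z) - f(a))/(z-a)^2 - l/(z-a) is o(1/|z-a|) at a, so its
    integral around the square of half side s tends to 0 with s.  By
    [rect_annulus] this integral does not depend on s. *)
Lemma cauchy_derivative l : cderiv f a l ->
  l * rect_winding a x1 x2 y1 y2 =
  rect_integral (fun z => (f z - f a) * ((z - a)^-1 * (z - a)^-1)) x1 x2 y1 y2.
Proof.
move=> fal.
have x12 : x1 <= x2 by case/andP: ax => u v; exact: ltW (lt_trans u v).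
have y12 : y1 <= y2 by case/andP: ay => u v; exact: ltW (lt_trans u v).
pose g z := (f z - f a) * ((z - a)^-1 * (z - a)^-1).
pose h z := 1 * g z + (- l) * (z - a)^-1.
have gd z : on_rect x1 x2 y1 y2 z -> z != a -> exists m, cderiv g z m.
  move=> /fd[m fm] za; eexists.
  apply: (cderivM (f := fun z => f z - f a) (g := fun z => (z - a)^-1 * (z - a)^-1)).
    by apply: (cderivB (f := f) (g := fun=> f a)); [exact: fm|exact: cderiv_cst].
  by apply: (cderivM (f := fun z => (z - a)^-1) (g := fun z => (z - a)^-1));
    exact: cderiv_inv.
have hd z : on_rect x1 x2 y1 y2 z -> z != a -> exists m, cderiv h z m.
  move=> zR za; have [m gm] := gd z zR za; eexists.
  apply: (cderivD (f := fun z => 1 * g z) (g := fun z => - l * (z - a)^-1)).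
    by apply: (cderivM (f := fun=> 1) (g := g)); [exact: cderiv_cst|exact: gm].
  by apply: (cderivM (f := fun=> - l) (g := fun z => (z - a)^-1)); [exact: cderiv_cst|exact:
    cderiv_inv].
have Eh : rect_integral h x1 x2 y1 y2 = 1 * rect_integral g x1 x2 y1 y2 + (- l) * rect_winding a
  x1 x2 y1 y2.
  apply: rect_lin => // z zb.
    have [m gm] := gd z (on_boundary_rect zb) (interior_not_boundary zb); exact:
      cderiv_continuous gm.
  exact: cderiv_continuous (cderiv_inv (interior_not_boundary zb)).
suff h0 : rect_integral h x1 x2 y1 y2 = 0.
  by move: Eh; rewrite h0 mul1r mulNr => /esym /eqP; rewrite subr_eq0 => /eqP ->.
apply/eqP; rewrite -cabs_eq0 eq_le cabs_ge0 andbT; apply/ler_addgt0Pr => e e0.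
rewrite add0r.
(* On the square |h| <= (e/8)/s, and the perimeter is 8 s: hence the 8. *)
have e8 : 0 < e / 8 by rewrite divr_gt0.
have [d d0 fe] := fal _ e8.
have [s0 s00 sP] := small_square.
pose s := Num.min (s0 / 2) (d / 4).
have sgt0 : 0 < s by rewrite lt_min !divr_gt0.
have ss0 : 0 < s < s0.
  by rewrite sgt0/= gt_min; apply/orP; left; lra.
have sd : 2 * s < d.
  have : s <= d / 4 by rewrite ge_min lexx orbT.
  lra.
have [h1 h2 h3 h4] := sP _ ss0.
rewrite (@rect_annulus _ _ _ _ _ (complex.Re a - s) (complex.Re a + s)
   (complex.Im a - s) (complex.Im a + s))//; last 3 first.
- lra.
- lra.
- by move=> z zR /(square_center sgt0); exact: hd.
apply: le_trans (cabs_rect_le_sup (M := e / 8 / s) _ _ _ _) _.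
- lra.
- lra.
- move=> z zb; have [sz _] := andP (square_boundary_dist sgt0 zb).
  have za : z != a by rewrite -subr_eq0 -cabs_gt0 (lt_le_trans sgt0).
  have zR : on_rect x1 x2 y1 y2 z.
    by move: zb => /andP[/andP[u v] _]; rewrite /on_rect; apply/andP; split; lra.
  have [m hm] := hd z zR za; exact: cderiv_continuous hm.
- move=> z zb; have [sz zs] := andP (square_boundary_dist sgt0 zb).
  have z0 : 0 < cabs (z - a) by exact: lt_le_trans sz.
  have za : z - a != 0 by rewrite -cabs_gt0.
  have -> : h z = (f z - f a - l * (z - a)) * ((z - a)^-1 * (z - a)^-1).
    by rewrite /h /g; field.
  rewrite !cabsM cabsV.
  apply: le_trans (_ : e / 8 * cabs (z - a) * ((cabs (z - a))^-1 * (cabs (z - a))^-1) <= _).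
    rewrite ler_wpM2r ?mulr_ge0 ?invr_ge0 ?cabs_ge0//.
    by apply: fe; exact: le_lt_trans sd.
  rewrite -mulrA mulrA -mulrA [X in _ * X]mulrA mulfV ?gt_eqF// mul1r.
  by rewrite ler_pM2l// lef_pV2.
- have -> : (complex.Re a + s - (complex.Re a - s) + (complex.Im a + s - (complex.Im a - s))) = 4
  * s by ring.
  rewrite le_eqVlt; apply/orP; left; apply/eqP; field.
  by rewrite gt_eqF.
Qed.

End formula.

End cauchy.

(** * Continuity of the derivative *)
Section derivative.
Context {R : realType}.
Notation mu := (@lebesgue_measure R).
Implicit Types (f g F : R[i] -> R[i]) (a z : R[i]).

(** Heine's theorem, by bisection.  The point b need not belong to the
    rectangle, which allows translates of the rectangle to be compared. *)
Lemma unif_continuous_rect f (x1 x2 y1 y2 e : R) : x1 < x2 -> y1 < y2 -> 0 < e ->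
  (forall z, on_rect x1 x2 y1 y2 z -> {for z, continuous (f : R[i]^o -> R[i]^o)}) ->
  exists2 d, 0 < d & forall z b, on_rect x1 x2 y1 y2 z -> cabs (b - z) < d ->
    cabs (f b - f z) < e.
Proof.
move=> x12 y12 e0 fc.
pose P x y d := exists2 r, 0 < r & forall z b,
  on_rect x (x + d * (x2 - x1)) y (y + d * (y2 - y1)) z -> cabs (b - z) < r ->
    cabs (f b - f z) < e.
suff : P x1 y1 1 by rewrite /P !mul1r ![_ + (_ - _)]addrC !subrK.
apply: (@bisection _ P x1 y1 (x2 - x1) (y2 - y1)); rewrite ?subr_gt0//.
- move=> x y d d0 [r1 r10 P1] [r2 r20 P2] [r3 r30 P3] [r4 r40 P4].
  exists (Num.min (Num.min r1 r2) (Num.min r3 r4)).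
    by rewrite !lt_min r10 r20 r30 r40.
  move=> z b /andP[/andP[z1 z2] /andP[z3 z4]].
  rewrite !lt_min => /andP[/andP[b1 b2] /andP[b3 b4]].
  have Ew : x + d * (x2 - x1) = x + d / 2 * (x2 - x1) + d / 2 * (x2 - x1) by field.
  have Eh : y + d * (y2 - y1) = y + d / 2 * (y2 - y1) + d / 2 * (y2 - y1) by field.
  rewrite Ew in z2; rewrite Eh in z4.
  have [zx|/ltW zx] := leP (complex.Re z) (x + d / 2 * (x2 - x1));
    have [zy|/ltW zy] := leP (complex.Im z) (y + d / 2 * (y2 - y1)).
  + by apply: P1 => //; rewrite /on_rect z1 zx z3 zy.
  + by apply: P3 => //; rewrite /on_rect z1 zx z4 zy.
  + by apply: P2 => //; rewrite /on_rect z2 zx z3 zy.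
  + by apply: P4 => //; rewrite /on_rect z2 zx z4 zy.
- move=> X Y; rewrite ![_ + (_ - _)]addrC !subrK => XX YY.
  have e2 : 0 < e / 2 by rewrite divr_gt0.
  have XYc : on_rect x1 x2 y1 y2 (Complex X Y) by rewrite /on_rect/= XX YY.
  have [r r0 fr] := (proj1 (continuous_cabsP f _) (fc _ XYc)) _ e2.
  pose K := (x2 - x1) + (y2 - y1).
  have K0 : 0 < K by rewrite addr_gt0 ?subr_gt0.
  exists (r / 2 / K); first by rewrite !divr_gt0.
  move=> x y d /andP[d0]; rewrite ltr_pdivlMr// => dK xX yY.
  exists (r / 2); first by rewrite divr_gt0.
  move=> z b /andP[z1 z2] bz.
  have zr : cabs (z - Complex X Y) < r / 2.
    apply: le_lt_trans dK; apply: le_trans (cabs_le_ReIm _) _.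
    rewrite /K mulrDr !raddfB/=.
    by apply: lerD; rewrite ler_norml; lra.
  have br : cabs (b - Complex X Y) < r.
    have -> : b - Complex X Y = (b - z) + (z - Complex X Y) by ring.
    by apply: le_lt_trans (cabsD _ _) _; rewrite [ltRHS]splitr; exact: ltrD.
  have zr' : cabs (z - Complex X Y) < r by apply: lt_le_trans zr _; lra.
  have -> : f b - f z = (f b - f (Complex X Y)) - (f z - f (Complex X Y)) by ring.
  apply: le_lt_trans (cabsD _ _) _; rewrite cabsN [ltRHS]splitr.
  by apply: ltrD; apply: fr.
Qed.

Definition cderive f : R[i] -> R[i] := derive1 (f : R[i]^o -> R[i]^o).

Lemma cderiv_shift_square f b (s : R) :
  (forall z, cabs (z - b) <= 2 * s -> exists l, cderiv f z l) ->
  forall w, on_rect (- s) s (- s) s w -> exists l, cderiv (fun w => f (b + w)) w l.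
Proof.
move=> fd w /andP[w1 w2].
have [l fl] : exists l, cderiv f (b + w) l.
  apply: fd; rewrite addrC addKr.
  apply: le_trans (cabs_le_ReIm _) _; rewrite mulr_natl mulr2n.
  by apply: lerD; rewrite ler_norml.
by exists l; exact: cderiv_shift.
Qed.

(** [cauchy_derivative] over the square of fixed size centred at b, translated
    to the origin, expresses the derivative at b as an integral whose integrand
    depends on b only through f(b+w) and f(b). *)
Lemma cderive_continuous f a (r : R) : 0 < r ->
  (forall z, cabs (z - a) < r -> exists l, cderiv f z l) ->
  {for a, continuous (cderive f : R[i]^o -> R[i]^o)}.
Proof.
move=> r0 fd; apply/continuous_cabsP => e e0.
pose s := r / 4.
have s0 : 0 < s by rewrite divr_gt0.
have ss : - s < s by lra.
have s00 : - s < complex.Re (0 : R[i]) < s by rewrite /=; lra.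
have s01 : - s < complex.Im (0 : R[i]) < s by rewrite /=; lra.
pose W := rect_winding 0 (- s) s (- s) s.
have W4 : 4 <= cabs W by exact: rect_winding_ge4.
have near_d b : cabs (b - a) < s -> forall z, cabs (z - b) <= 2 * s -> exists l, cderiv f z l.
  move=> ba z zb; apply: fd.
  have -> : z - a = (z - b) + (b - a) by ring.
  apply: le_lt_trans (cabsD _ _) _; rewrite /s in ba zb; lra.
pose g b (w : R[i]) := (f (b + w) - f (b + 0)) * ((w - 0)^-1 * (w - 0)^-1).
have form b : cabs (b - a) < s -> cderive f b * W = rect_integral (g b) (- s) s (- s) s.
  move=> ba.
  have [l fl] : exists l, cderiv f b l.
    by apply: near_d ba _ _; rewrite subrr cabs0; lra.
  rewrite /cderive (cderiv_derive1 fl).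
  apply: (cauchy_derivative s00 s01 (f := fun w => f (b + w))).
    exact: cderiv_shift_square (near_d _ ba).
  by apply: cderiv_shift; rewrite addr0.
have gc b : cabs (b - a) < s -> forall w, on_boundary (- s) s (- s) s w ->
    {for w, continuous (g b : R[i]^o -> R[i]^o)}.
  move=> ba w wb.
  have w0 := interior_not_boundary s00 s01 wb.
  have [m fm] := cderiv_shift_square (near_d _ ba) (on_boundary_rect wb).
  apply: cderiv_continuous.
  apply: (cderivM (f := fun w => f (b + w) - f (b + 0)) (g := fun z => (z - 0)^-1 * (z - 0)^-1)).
    by apply: (cderivB (f := fun w => f (b + w)) (g := fun=> f (b + 0))); [exact: fm|exact:
      cderiv_cst].
  by apply: (cderivM (f := fun z => (z - 0)^-1) (g := fun z => (z - 0)^-1));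
    exact: cderiv_inv.
(* A difference 2 e1 / s^2 of the integrands over the perimeter 8 s, divided
   by |W| >= 4, leaves less than e. *)
pose e1 := e * s / 16.
have e10 : 0 < e1 by rewrite divr_gt0// mulr_gt0.
have aa : cabs (a - a) < s by rewrite subrr cabs0.
have [d d0 fu] := @unif_continuous_rect (fun w => f (a + w)) (- s) s (- s) s e1 ss ss e10
  (fun w wR => let: ex_intro l fl := cderiv_shift_square (near_d _ aa) wR in cderiv_continuous fl).
exists (Num.min d s); first by rewrite lt_min d0 s0.
move=> b; rewrite lt_min => /andP[bd bs].
have close w : on_rect (- s) s (- s) s w -> cabs (f (b + w) - f (a + w)) < e1.
  move=> wR; have := fu w (w + (b - a)) wR.
  have -> : w + (b - a) - w = b - a by ring.
  have -> : a + (w + (b - a)) = b + w by ring.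
  by apply.
have zR : on_rect (- s) s (- s) s (0 : R[i]) by rewrite /on_rect/=; lra.
have E : (cderive f b - cderive f a) * W = rect_integral (fun w => 1 * g b w + (-1) * g a w) (-
  s) s (- s) s.
  rewrite (rect_lin _ _ 1 (-1) (gc b bs) (gc a aa)); [|lra|lra].
  have combine_scaled (p q u v w : R[i]) : p * w = u -> q * w = v -> (p - q) * w = 1 * u + -1 * v.
    by move=> <- <-; ring.
  exact: combine_scaled (form b bs) (form a aa).
have B : cabs ((cderive f b - cderive f a) * W) <= 2 * (2 * e1 / s ^+ 2) * (s - - s + (s - - s)).
  rewrite E; apply: cabs_rect_le_sup; [lra|lra| |].
  - move=> w wb.
    exact: (@continuous_add _ R[i]^o _ _ w (@continuous_mulc _ R[i]^o _ 1 w (gc b bs w wb))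
      (@continuous_mulc _ R[i]^o _ (-1) w (gc a aa w wb))).
  - move=> w wb.
    have -> : 1 * g b w + -1 * g a w =
      ((f (b + w) - f (a + w)) - (f (b + 0) - f (a + 0))) * ((w - 0)^-1 * (w - 0)^-1).
      by rewrite /g; ring.
    have sw : s <= cabs (w - 0).
      have wb' : on_boundary (complex.Re (0 : R[i]) - s) (complex.Re (0 : R[i]) + s)
         (complex.Im (0 : R[i]) - s) (complex.Im (0 : R[i]) + s) w.
        by rewrite /= !add0r.
      by have [] := andP (square_boundary_dist s0 wb').
    rewrite !cabsM cabsV; apply: ler_pM.
    + exact: cabs_ge0.
    + by rewrite mulr_ge0// invr_ge0 cabs_ge0.
    + apply: le_trans (cabsD _ _) _; rewrite cabsN mulr_natl mulr2n.
      by apply: lerD; apply/ltW; apply: close => //; exact: on_boundary_rect.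
    + rewrite expr2 invfM; apply: ler_pM; rewrite ?invr_ge0 ?cabs_ge0//.
        by rewrite lef_pV2// posrE (lt_le_trans s0).
      by rewrite lef_pV2// posrE (lt_le_trans s0).
have : cabs (cderive f b - cderive f a) * 4 <= e.
  apply: le_trans (_ : cabs ((cderive f b - cderive f a) * W) <= _).
    by rewrite cabsM ler_wpM2l// cabs_ge0.
  apply: le_trans B _; rewrite le_eqVlt; apply/orP; left; apply/eqP.
  by rewrite /e1; field; rewrite gt_eqF.
lra.
Qed.

(** Integration by parts: (f(z)-f(a))/(z-a) is a primitive of
    f'(z)/(z-a) - (f(z)-f(a))/(z-a)^2 on the contour. *)
Lemma cauchy_formula_derivative f a (x1 x2 y1 y2 : R) :
  x1 < complex.Re a < x2 -> y1 < complex.Im a < y2 ->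
  (forall z, on_rect x1 x2 y1 y2 z -> exists l, cderiv f z l) ->
  (forall z, on_rect x1 x2 y1 y2 z -> {for z, continuous (cderive f : R[i]^o -> R[i]^o)}) ->
  cderive f a * rect_winding a x1 x2 y1 y2 = rect_integral (fun z => cderive f z * (z - a)^-1) x1
    x2 y1 y2.
Proof.
move=> ax ay fd f'c.
have x12 : x1 <= x2 by case/andP: ax => u v; exact: ltW (lt_trans u v).
have y12 : y1 <= y2 by case/andP: ay => u v; exact: ltW (lt_trans u v).
have aR : on_rect x1 x2 y1 y2 a.
  by case/andP: ax => u v; case/andP: ay => p q; rewrite /on_rect !ltW.
have fderiv z : on_rect x1 x2 y1 y2 z -> cderiv f z (cderive f z).
  by move=> /fd[l fl]; rewrite /cderive (cderiv_derive1 fl).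
apply: etrans (cauchy_derivative ax ay fd (fderiv _ aR)) _.
pose g z := (f z - f a) * ((z - a)^-1 * (z - a)^-1).
pose h z := cderive f z * (z - a)^-1.
have Gd z : on_boundary x1 x2 y1 y2 z -> cderiv (fun z => (f z - f a) * (z - a)^-1) z
    (1 * h z + (-1) * g z).
  move=> zb; have za := interior_not_boundary ax ay zb.
  have -> : 1 * h z + -1 * g z = (cderive f z - 0) * (z - a)^-1 + (f z - f a) * (- 1 / (z - a) ^+
    2).
    by rewrite /h /g; field; rewrite subr_eq0.
  apply: (cderivM (f := fun z => f z - f a) (g := fun z => (z - a)^-1)); last exact: cderiv_inv.
  by apply: (cderivB (f := f) (g := fun=> f a)); [exact: fderiv (on_boundary_rect zb)|exact:
    cderiv_cst].
have invc z : on_boundary x1 x2 y1 y2 z ->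
    {for z, continuous ((fun z => (z - a)^-1) : R[i]^o -> R[i]^o)}.
  by move=> zb; exact: cderiv_continuous (cderiv_inv (interior_not_boundary ax ay zb)).
have hc z : on_boundary x1 x2 y1 y2 z -> {for z, continuous (h : R[i]^o -> R[i]^o)}.
  move=> zb.
  exact: (@continuousM R[i] R[i]^o (cderive f) (fun z => (z - a)^-1) z (f'c z (on_boundary_rect
    zb)) (invc z zb)).
have gc z : on_boundary x1 x2 y1 y2 z -> {for z, continuous (g : R[i]^o -> R[i]^o)}.
  move=> zb; apply: cderiv_continuous.
  apply: (cderivM (f := fun z => f z - f a) (g := fun z => (z - a)^-1 * (z - a)^-1)).
    by apply: (cderivB (f := f) (g := fun=> f a)); [exact: fderiv (on_boundary_rect zb)|exact:
      cderiv_cst].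
  by apply: (cderivM (f := fun z => (z - a)^-1) (g := fun z => (z - a)^-1));
    exact: cderiv_inv (interior_not_boundary ax ay zb).
have := rect_lin x12 y12 1 (-1) hc gc.
rewrite (rect_FTC x12 y12 _ Gd); last first.
  move=> z zb.
  exact: (@continuous_add _ R[i]^o _ _ z (@continuous_mulc _ R[i]^o _ 1 z (hc z zb))
    (@continuous_mulc _ R[i]^o _ (-1) z (gc z zb))).
by rewrite mul1r mulN1r => /esym /eqP; rewrite subr_eq0 => /eqP ->.
Qed.

End derivative.

(** * A sub-mean-value inequality *)
Section strips.
Context {R : realType}.
Notation mu := (@lebesgue_measure R).
Notation RR := (measurableTypeR R * measurableTypeR R)%type.

(** Tonelli's theorem, keeping only the vertical segments over [c, d]. *)
Lemma vertical_strip (D : set RR) (F : RR -> R) (c d y1 y2 k : R) :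
  measurable D -> measurable_fun D F -> (forall w, D w -> 0 <= F w) ->
  c <= d -> 0 <= k ->
  (forall x y, c <= x <= d -> y1 <= y <= y2 -> D (x, y)) ->
  (forall x, c <= x <= d -> (k%:E <= \int[mu]_(y in `[y1, y2]) (F (x, y))%:E)%E) ->
  ((k * (d - c))%:E <= \int[(mu \x mu)%E]_(w in D) (F w)%:E)%E.
Proof.
move=> mD mF F0 cd k0 XYD kF.
pose G : RR -> \bar R := (EFin \o F) \_ D.
have mG : measurable_fun [set: RR] G.
  by apply/(measurable_restrictT _ mD); exact/measurable_EFinP.
have G0 w : (0 <= G w)%E.
  by rewrite /G patchE; case: ifPn => //; rewrite inE => /F0; rewrite lee_fin.
rewrite integral_mkcond (fubini_tonelli1 _ mG G0).
apply: (@le_trans _ _ (\int[mu]_(x in `[c, d]) (fubini_F mu G x))%E); last first.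
  apply: ge0_subset_integral => //.
  - exact: measurable_fun_fubini_tonelli_F.
  - by move=> x _; apply: integral_ge0.
apply: (@le_trans _ _ (\int[mu]_(x in `[c, d]) k%:E)%E).
  rewrite integral_cst//= lebesgue_measure_itv/= lte_fin.
  have [cd'|dc] := ltP c d; first by rewrite EFinM.
  by rewrite mule0 lee_fin mulr_ge0_le0 ?subr_le0.
apply: ge0_le_integral => //.
- apply: measurable_funTS; exact: measurable_fun_fubini_tonelli_F.
- move=> x /=; rewrite in_itv/= => xcd; apply: le_trans (kF x xcd) _.
  apply: (@le_trans _ _ (\int[mu]_(y in `[y1, y2]) G (x, y))%E).
    rewrite le_eqVlt; apply/orP; left; apply/eqP; apply: eq_integral => y.
    rewrite inE/= in_itv/= => yy; rewrite /G patchE mem_set//; exact: XYD.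
  apply: ge0_subset_integral => //.
  by apply: measurableT_comp => //; exact: pair1_measurable.
Qed.

Lemma horizontal_strip (D : set RR) (F : RR -> R) (c d x1 x2 k : R) :
  measurable D -> measurable_fun D F -> (forall w, D w -> 0 <= F w) ->
  c <= d -> 0 <= k ->
  (forall x y, x1 <= x <= x2 -> c <= y <= d -> D (x, y)) ->
  (forall y, c <= y <= d -> (k%:E <= \int[mu]_(x in `[x1, x2]) (F (x, y))%:E)%E) ->
  ((k * (d - c))%:E <= \int[(mu \x mu)%E]_(w in D) (F w)%:E)%E.
Proof.
move=> mD mF F0 cd k0 XYD kF.
pose G : RR -> \bar R := (EFin \o F) \_ D.
have mG : measurable_fun [set: RR] G.
  by apply/(measurable_restrictT _ mD); exact/measurable_EFinP.
have G0 w : (0 <= G w)%E.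
  by rewrite /G patchE; case: ifPn => //; rewrite inE => /F0; rewrite lee_fin.
rewrite integral_mkcond (fubini_tonelli2 _ mG G0).
apply: (@le_trans _ _ (\int[mu]_(y in `[c, d]) (fubini_G mu G y))%E); last first.
  apply: ge0_subset_integral => //.
  - exact: measurable_fun_fubini_tonelli_G.
  - by move=> x _; apply: integral_ge0.
apply: (@le_trans _ _ (\int[mu]_(x in `[c, d]) k%:E)%E).
  rewrite integral_cst//= lebesgue_measure_itv/= lte_fin.
  have [cd'|dc] := ltP c d; first by rewrite EFinM.
  by rewrite mule0 lee_fin mulr_ge0_le0 ?subr_le0.
apply: ge0_le_integral => //.
- apply: measurable_funTS; exact: measurable_fun_fubini_tonelli_G.
- move=> y /=; rewrite in_itv/= => ycd; apply: le_trans (kF y ycd) _.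
  apply: (@le_trans _ _ (\int[mu]_(x in `[x1, x2]) G (x, y))%E).
    rewrite le_eqVlt; apply/orP; left; apply/eqP; apply: eq_integral => x.
    rewrite inE/= in_itv/= => yy; rewrite /G patchE mem_set//; exact: XYD.
  apply: ge0_subset_integral => //.
  by apply: measurableT_comp => //; exact: pair2_measurable.
Qed.

End strips.

Section local_L2_bound.
Context {R : realType}.
Notation mu := (@lebesgue_measure R).
Notation RR := (measurableTypeR R * measurableTypeR R)%type.

Lemma Rintegral_subset (w : R -> R) (C c d D : R) : C <= c -> c <= d -> d <= D ->
  (forall t, C <= t <= D -> {for t, continuous w}) ->
  (forall t, C <= t <= D -> 0 <= w t) ->
  \int[mu]_(t in `[c, d]) w t <= \int[mu]_(t in `[C, D]) w t.
Proof.
move=> Cc cd dD wc w0.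
have cD : c <= D := le_trans cd dD.
rewrite (@Rintegral_add _ w C D c) ?Cc//.
rewrite (@Rintegral_add _ w c D d) ?cd//; last first.
  by move=> t /andP[ct tD]; apply: wc; rewrite (le_trans Cc ct).
have I1 : 0 <= \int[mu]_(t in `[C, c]) w t.
  apply: Rintegral_ge0 => t; rewrite /= in_itv/= => /andP[Ct tc].
  by apply: w0; rewrite Ct (le_trans tc cD).
have I2 : 0 <= \int[mu]_(t in `[d, D]) w t.
  apply: Rintegral_ge0 => t; rewrite /= in_itv/= => /andP[dt tD].
  by apply: w0; rewrite tD (le_trans (le_trans Cc cd) dt).
by rewrite addrCA lerDl addr_ge0.
Qed.

(** The inequality 2 la u <= la^2 + u^2 replaces the first power of u by its
    square, with a parameter la to be balanced later. *)
Lemma side_le (u k : R -> R) (C c d D S la : R) : 0 < S -> 0 < la ->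
  C <= c -> c <= d -> d <= D -> D - C = 2 * S ->
  (forall t, C <= t <= D -> {for t, continuous u}) ->
  (forall t, c <= t <= d -> {for t, continuous k}) ->
  (forall t, c <= t <= d -> k t <= (S / 2)^-1 * u t) ->
  \int[mu]_(t in `[c, d]) k t <=
  2 * la + (S * la)^-1 * \int[mu]_(t in `[C, D]) (u t ^+ 2).
Proof.
move=> S0 la0 Cc cd dD DC uc kc ku.
pose w t := la / S * 1 + (S * la)^-1 * (u t ^+ 2).
have u2c t : C <= t <= D -> {for t, continuous (fun t => u t ^+ 2)}.
  by move=> /uc uct; exact: (continuousM uct uct).
have wc t : C <= t <= D -> {for t, continuous w}.
  move=> tCD; apply: continuousD; apply: continuousM; try exact: cst_continuous.
  exact: u2c.
have lc t : C <= t <= D -> {for t, continuous (fun=> 1 : R)} by move=> _; exact: cst_continuous.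
have EW : \int[mu]_(t in `[C, D]) w t = 2 * la + (S * la)^-1 * \int[mu]_(t in `[C, D]) (u t ^+ 2).
  rewrite (Rintegral_lin (la / S) (S * la)^-1 lc u2c); congr (_ + _).
  rewrite Rintegral_cst//= lebesgue_measure_itv/= lte_fin.
  have -> : C < D by lra.
  by rewrite /= DC; field; rewrite gt_eqF.
rewrite -EW.
apply: (@le_trans _ _ (\int[mu]_(t in `[c, d]) w t)).
- apply: le_Rintegral => //.
  + exact: segment_integrable.
  + apply: segment_integrable => t /andP[ct td]; apply: wc.
    by rewrite (le_trans Cc ct) (le_trans td dD).
  + move=> t; rewrite /= in_itv/= => /ku; move=> /le_trans; apply.
    have -> : w t = (S / 2)^-1 * u t + (la - u t) ^+ 2 / (S * la).
      by rewrite /w; field; rewrite !gt_eqF.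
    by rewrite lerDl divr_ge0 ?sqr_ge0// mulr_ge0 ?ltW.
- apply: (Rintegral_subset Cc cd dD wc) => t _.
  have Sla : 0 <= (S * la)^-1 by rewrite invr_ge0 mulr_ge0 ?ltW.
  have laS : 0 <= la / S by rewrite divr_ge0 ?ltW.
  by rewrite /w mulr1 addr_ge0// mulr_ge0// sqr_ge0.
Qed.

Variables (f : R[i] -> R[i]) (a : R[i]) (S : R).
Hypothesis S0 : 0 < S.
Let Q := on_rect (complex.Re a - S) (complex.Re a + S) (complex.Im a - S) (complex.Im a + S).
Hypothesis fd : forall z, Q z -> exists l, cderiv f z l.
Hypothesis f'c : forall z, Q z -> {for z, continuous (cderive f : R[i]^o -> R[i]^o)}.

Let V x := \int[mu]_(t in `[complex.Im a - S, complex.Im a + S]) (cabs (cderive f (Complex x t))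
  ^+ 2).
Let H y := \int[mu]_(t in `[complex.Re a - S, complex.Re a + S]) (cabs (cderive f (Complex t y))
  ^+ 2).

Let V_cont x t : complex.Re a - S <= x <= complex.Re a + S ->
  complex.Im a - S <= t <= complex.Im a + S ->
  {for t, continuous (fun t => cabs (cderive f (Complex x t)))}.
Proof.
by move=> xQ tQ; apply: continuous_cabs_comp; apply: continuous_vline; apply: f'c; rewrite /Q
  /on_rect/= xQ tQ.
Qed.

Let H_cont y t : complex.Im a - S <= y <= complex.Im a + S ->
  complex.Re a - S <= t <= complex.Re a + S ->
  {for t, continuous (fun t => cabs (cderive f (Complex t y)))}.
Proof.
by move=> yQ tQ; apply: continuous_cabs_comp; apply: continuous_hline; apply: f'c; rewrite /Q
  /on_rect/= yQ tQ.
Qed.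

Let absorb_half (s A T : R) : 0 < s -> 0 < A ->
  0 <= T -> 4 * A <= 8 * (A / 4) + (s * (A / 4))^-1 * T -> s * A ^+ 2 <= 2 * T.
Proof.
move=> s0 A0 T0.
have -> : 8 * (A / 4) = 2 * A by field.
have -> : (s * (A / 4))^-1 * T = 4 * T / (s * A) by field; rewrite !gt_eqF.
rewrite -lerBlDl.
have -> : 4 * A - 2 * A = 2 * A by ring.
rewrite ler_pdivlMr ?mulr_gt0// => le2.
have -> : s * A ^+ 2 = (2 * A * (s * A)) / 2 by field.
lra.
Qed.

Let sum_of_sides (l s p q u v : R) : 8 * l + s * (p + q + u + v) =
  (2 * l + s * p) + (2 * l + s * q) + (2 * l + s * u) + (2 * l + s * v).
Proof. by ring. Qed.

(** Cauchy's formula with |W| >= 4 and |z-a| >= S/2 on the contour.  With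
    la = |f'(a)|/4 the constant terms of [side_le] add up to half of the
    left-hand side 4 |f'(a)| and are absorbed. *)
Lemma four_sides_bound x1 x2 y1 y2 :
  complex.Re a - S <= x1 <= complex.Re a - S / 2 ->
  complex.Re a + S / 2 <= x2 <= complex.Re a + S ->
  complex.Im a - S <= y1 <= complex.Im a - S / 2 ->
  complex.Im a + S / 2 <= y2 <= complex.Im a + S ->
  S * cabs (cderive f a) ^+ 2 <= 2 * (H y1 + V x2 + H y2 + V x1).
Proof.
move=> X1 X2 Y1 Y2; have S2 : 0 < S / 2 by rewrite divr_gt0.
have ax : x1 < complex.Re a < x2 by lra.
have ay : y1 < complex.Im a < y2 by lra.
have x12 : x1 <= x2 by lra.
have y12 : y1 <= y2 by lra.
have x1Q : complex.Re a - S <= x1 <= complex.Re a + S by lra.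
have x2Q : complex.Re a - S <= x2 <= complex.Re a + S by lra.
have y1Q : complex.Im a - S <= y1 <= complex.Im a + S by lra.
have y2Q : complex.Im a - S <= y2 <= complex.Im a + S by lra.
have sub z : on_rect x1 x2 y1 y2 z -> Q z.
  by case/andP => u v; rewrite /Q /on_rect; lra.
have E := cauchy_formula_derivative ax ay (fun z zR => fd (sub z zR)) (fun z zR => f'c (sub z zR)).
pose h z := cderive f z * (z - a)^-1.
have hc z : on_boundary x1 x2 y1 y2 z -> {for z, continuous (h : R[i]^o -> R[i]^o)}.
  move=> zb.
  exact: (@continuousM R[i] R[i]^o (cderive f) (fun z => (z - a)^-1) z (f'c (sub _
    (on_boundary_rect zb)))
    (cderiv_continuous (cderiv_inv (interior_not_boundary ax ay zb)))).
have far z : on_boundary x1 x2 y1 y2 z -> cabs (h z) <= (S / 2)^-1 * cabs (cderive f z).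
  move=> zb; rewrite cabsM mulrC ler_wpM2r ?cabs_ge0// cabsV lef_pV2 ?posrE ?divr_gt0//.
    have ReB : complex.Re (z - a) = complex.Re z - complex.Re a by rewrite raddfB.
    have ImB : complex.Im (z - a) = complex.Im z - complex.Im a by rewrite raddfB.
    move: zb => /andP[_ /or4P[] /eqP Ez].
    + by apply: le_trans _ (ler_Re_cabs _); rewrite ReB Ez ler0_norm; lra.
    + by apply: le_trans _ (ler_Re_cabs _); rewrite ReB Ez ger0_norm; lra.
    + by apply: le_trans _ (ler_Im_cabs _); rewrite ImB Ez ler0_norm; lra.
    + by apply: le_trans _ (ler_Im_cabs _); rewrite ImB Ez ger0_norm; lra.
  by rewrite cabs_gt0 subr_eq0; exact: interior_not_boundary ax ay _ zb.
have VH0 : 0 <= H y1 + V x2 + H y2 + V x1.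
  by rewrite !addr_ge0//; apply: Rintegral_ge0 => t _; exact: sqr_ge0.
have [A0|A0] := eqVneq (cabs (cderive f a)) 0.
  by rewrite A0 expr0n/= mulr0 mulr_ge0.
have {}A0 : 0 < cabs (cderive f a) by rewrite lt_def A0 cabs_ge0.
have W4 := rect_winding_ge4 ax ay.
pose la := cabs (cderive f a) / 4.
have la0 : 0 < la by rewrite divr_gt0.
have DC (v : R) : v + S - (v - S) = 2 * S by ring.
have [X11 X12] := andP X1; have [X21 X22] := andP X2.
have [Y11 Y12] := andP Y1; have [Y21 Y22] := andP Y2.
have B1 : \int[mu]_(t in `[x1, x2]) cabs (h (Complex t y1)) <= 2 * la + (S * la)^-1 * H y1.
  apply: (side_le (u := fun t => cabs (cderive f (Complex t y1))) S0 la0 X11 x12 X22 (DC _)).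
  - by move=> t; exact: H_cont.
  - by move=> t tx; apply: continuous_cabs_comp; exact: (continuous_bottom y12 hc tx).
  - by move=> t tx; apply: far; exact: on_bd_bottom.
have B2 : \int[mu]_(t in `[y1, y2]) cabs (h (Complex x2 t)) <= 2 * la + (S * la)^-1 * V x2.
  apply: (side_le (u := fun t => cabs (cderive f (Complex x2 t))) S0 la0 Y11 y12 Y22 (DC _)).
  - by move=> t; exact: V_cont.
  - by move=> t tx; apply: continuous_cabs_comp; exact: (continuous_right x12 hc tx).
  - by move=> t tx; apply: far; exact: on_bd_right.
have B3 : \int[mu]_(t in `[x1, x2]) cabs (h (Complex t y2)) <= 2 * la + (S * la)^-1 * H y2.
  apply: (side_le (u := fun t => cabs (cderive f (Complex t y2))) S0 la0 X11 x12 X22 (DC _)).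
  - by move=> t; exact: H_cont.
  - by move=> t tx; apply: continuous_cabs_comp; exact: (continuous_top y12 hc tx).
  - by move=> t tx; apply: far; exact: on_bd_top.
have B4 : \int[mu]_(t in `[y1, y2]) cabs (h (Complex x1 t)) <= 2 * la + (S * la)^-1 * V x1.
  apply: (side_le (u := fun t => cabs (cderive f (Complex x1 t))) S0 la0 Y11 y12 Y22 (DC _)).
  - by move=> t; exact: V_cont.
  - by move=> t tx; apply: continuous_cabs_comp; exact: (continuous_left x12 hc tx).
  - by move=> t tx; apply: far; exact: on_bd_left.
have T := cabs_rect_le x12 y12 hc.
rewrite -/h in E.
have : 4 * cabs (cderive f a) <= 8 * la + (S * la)^-1 * (H y1 + V x2 + H y2 + V x1).
  apply: le_trans (_ : cabs (rect_integral h x1 x2 y1 y2) <= _).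
    by rewrite -E cabsM mulrC ler_wpM2l ?cabs_ge0.
  apply: le_trans T _.
  rewrite sum_of_sides.
  exact: (lerD (lerD (lerD B1 B2) B3) B4).
move: VH0; set T4 := H y1 + _ + _ + _; exact: absorb_half.
Qed.

Let small_sides_absurd (p q u v w : R) : p < w / 8 -> q < w / 8 -> u < w / 8 -> v < w / 8 ->
  w <= 2 * (p + q + u + v) -> False.
Proof. by move=> *; lra. Qed.

(** If the bound failed, Tonelli's theorem would provide, in each of the four
    strips at distance between S/2 and S from a, a line on which the
    integral of |f'|^2 is less than S |f'(a)|^2 / 8; the rectangle formed by these
    lines would contradict [four_sides_bound].  A weight bounded below by ka is
    built in through F. *)
Lemma local_L2_bound (D : set RR) (F : RR -> R) (ka : R) : 0 <= ka ->
  measurable D -> measurable_fun D F -> (forall w, D w -> 0 <= F w) ->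
  (forall x y, Q (Complex x y) -> D (x, y) /\
     ka * cabs (cderive f (Complex x y)) ^+ 2 <= F (x, y)) ->
  ((ka * (S ^+ 2 * cabs (cderive f a) ^+ 2 / 16))%:E <= \int[(mu \x mu)%E]_(w in D) (F w)%:E)%E.
Proof.
move=> ka0 mD mF F0 QF.
set A2 := cabs (cderive f a) ^+ 2.
have A20 : 0 <= A2 by exact: sqr_ge0.
have -> : ka * (S ^+ 2 * A2 / 16) = ka * (S * A2 / 8) * (S / 2) by field.
have k0 : 0 <= ka * (S * A2 / 8) by rewrite mulr_ge0// divr_ge0// mulr_ge0// ltW.
have S2 : 0 <= S / 2 by rewrite divr_ge0 ?ltW.
set I := (\int[_]_(w in D) _)%E.
have EI (P : R -> R) c d : (forall t, c <= t <= d -> {for t, continuous P}) ->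
    ((\int[mu]_(t in `[c, d]) P t)%:E = \int[mu]_(t in `[c, d]) (P t)%:E)%E.
  by move=> Pc; rewrite /Rintegral fineK// integrable_fin_num//; exact: segment_integrable.
have vert c d : d - c = S / 2 -> complex.Re a - S <= c -> d <= complex.Re a + S ->
    ((ka * (S * A2 / 8) * (S / 2))%:E <= I)%E \/ exists2 x, c <= x <= d & V x < S * A2 / 8.
  move=> dc cQ dQ; have cd : c <= d by lra.
  have [hx|hx] := pselect (exists2 x, c <= x <= d & V x < S * A2 / 8); [by right|left].
  rewrite -dc; apply: (@vertical_strip _ D F c d (complex.Im a - S) (complex.Im a + S)) => //.
    move=> x y xcd yQ; have [] // := QF x y.
    by rewrite /Q /on_rect/= yQ; lra.
  move=> x xcd.
  have xQ : complex.Re a - S <= x <= complex.Re a + S by lra.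
  have Vx : S * A2 / 8 <= V x.
    by rewrite leNgt; apply/negP => Vx; apply: hx; exists x.
  have V2c t : complex.Im a - S <= t <= complex.Im a + S ->
      {for t, continuous (fun t => ka * cabs (cderive f (Complex x t)) ^+ 2)}.
    move=> tQ; apply: continuousM; first exact: cst_continuous.
    exact: (continuousM (V_cont xQ tQ) (V_cont xQ tQ)).
  have V2c' t : complex.Im a - S <= t <= complex.Im a + S ->
      {for t, continuous (fun t => cabs (cderive f (Complex x t)) ^+ 2)}.
    by move=> tQ; exact: (continuousM (V_cont xQ tQ) (V_cont xQ tQ)).
  apply: (@le_trans _ _ (ka * V x)%:E).
    by rewrite lee_fin ler_wpM2l.
  rewrite /V -RintegralZl//; last exact: segment_integrable.
  rewrite EI//.
  have mFx : measurable_fun `[complex.Im a - S, complex.Im a + S] (fun y : measurableTypeR R => F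
    (x, y)).
    apply: (@measurable_comp _ _ _ _ _ _ D) => //; last exact: measurable_funTS (pair1_measurable
      x).
    move=> _ [y + <-]; rewrite /= in_itv/= => yQ; have [] // := QF x y.
    by rewrite /Q /on_rect/= xQ yQ.
  apply: ge0_le_integral => //.
  - by move=> t _; rewrite lee_fin mulr_ge0 ?sqr_ge0.
  - by case/integrableP: (segment_integrable V2c).
  - exact/measurable_EFinP.
  - move=> t; rewrite /= in_itv/= => tQ; rewrite lee_fin; have [] // := QF x t.
    by rewrite /Q /on_rect/= xQ tQ.
have horiz c d : d - c = S / 2 -> complex.Im a - S <= c -> d <= complex.Im a + S ->
    ((ka * (S * A2 / 8) * (S / 2))%:E <= I)%E \/ exists2 y, c <= y <= d & H y < S * A2 / 8.
  move=> dc cQ dQ; have cd : c <= d by lra.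
  have [hy|hy] := pselect (exists2 y, c <= y <= d & H y < S * A2 / 8); [by right|left].
  rewrite -dc; apply: (@horizontal_strip _ D F c d (complex.Re a - S) (complex.Re a + S)) => //.
    move=> x y xQ ycd; have [] // := QF x y.
    by rewrite /Q /on_rect/= xQ; lra.
  move=> y ycd.
  have yQ : complex.Im a - S <= y <= complex.Im a + S by lra.
  have Hy : S * A2 / 8 <= H y.
    by rewrite leNgt; apply/negP => Hy; apply: hy; exists y.
  have V2c t : complex.Re a - S <= t <= complex.Re a + S ->
      {for t, continuous (fun t => ka * cabs (cderive f (Complex t y)) ^+ 2)}.
    move=> tQ; apply: continuousM; first exact: cst_continuous.
    exact: (continuousM (H_cont yQ tQ) (H_cont yQ tQ)).
  have V2c' t : complex.Re a - S <= t <= complex.Re a + S ->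
      {for t, continuous (fun t => cabs (cderive f (Complex t y)) ^+ 2)}.
    by move=> tQ; exact: (continuousM (H_cont yQ tQ) (H_cont yQ tQ)).
  apply: (@le_trans _ _ (ka * H y)%:E).
    by rewrite lee_fin ler_wpM2l.
  rewrite /H -RintegralZl//; last exact: segment_integrable.
  rewrite EI//.
  have mFy : measurable_fun `[complex.Re a - S, complex.Re a + S] (fun x : measurableTypeR R => F
    (x, y)).
    apply: (@measurable_comp _ _ _ _ _ _ D) => //; last exact: measurable_funTS (pair2_measurable
      y).
    move=> _ [x + <-]; rewrite /= in_itv/= => xQ; have [] // := QF x y.
    by rewrite /Q /on_rect/= xQ yQ.
  apply: ge0_le_integral => //.
  - by move=> t _; rewrite lee_fin mulr_ge0 ?sqr_ge0.
  - by case/integrableP: (segment_integrable V2c).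
  - exact/measurable_EFinP.
  - move=> t; rewrite /= in_itv/= => tQ; rewrite lee_fin; have [] // := QF t y.
    by rewrite /Q /on_rect/= yQ tQ.
have r1 (v : R) : v - S / 2 - (v - S) = S / 2 by field.
have r2 (v : R) : v + S - (v + S / 2) = S / 2 by field.
have r3 (v : R) : v - S / 2 <= v + S.
  by rewrite lerD2l; apply: (@le_trans _ _ 0); rewrite ?oppr_le0// ltW.
have r4 (v : R) : v - S <= v + S / 2.
  by rewrite lerD2l; apply: (@le_trans _ _ 0); rewrite ?oppr_le0// ltW.
case: (vert _ _ (r1 (complex.Re a)) (lexx _) (r3 _)) => [//|[x1 X1 V1]].
case: (vert _ _ (r2 (complex.Re a)) (r4 _) (lexx _)) => [//|[x2 X2 V2]].
case: (horiz _ _ (r1 (complex.Im a)) (lexx _) (r3 _)) => [//|[y1 Y1 H1]].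
case: (horiz _ _ (r2 (complex.Im a)) (r4 _) (lexx _)) => [//|[y2 Y2 H2]].
have := four_sides_bound X1 X2 Y1 Y2; rewrite -/A2.
by move=> /(small_sides_absurd H1 V2 H2 V1).
Qed.

End local_L2_bound.

(** * Measurability of the integrand *)
Section measurability.
Context {R : realType}.
Notation mu := (@lebesgue_measure R).
Notation RR := (measurableTypeR R * measurableTypeR R)%type.

(** The product sigma-algebra contains the boxes with rational centre and
    rational radius, and an open set is the countable union of those that it
    contains. *)
Lemma measurable_fun_locally_continuous (D : set RR) (F : RR -> R) : measurable D ->
  (forall x y, D (x, y) -> forall e, 0 < e -> exists2 d, 0 < d & forall x' y',
     `|x' - x| < d -> `|y' - y| < d -> `|F (x', y') - F (x, y)| < e) ->
  measurable_fun D F.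
Proof.
move=> mD Fc mD'; apply: (measurability _ (RGenOInfty.measurableE R)) => //.
move=> /= _ [_ [c ->] <-].
pose box (q1 q2 q3 : rat) : set RR :=
  [set` `](ratr q1 - ratr q3 : R), (ratr q1 + ratr q3)[] `*`
  [set` `](ratr q2 - ratr q3 : R), (ratr q2 + ratr q3)[].
pose B q1 q2 q3 : set RR :=
  if `[< box q1 q2 q3 `<=` [set w | c < F w] >] then box q1 q2 q3 else set0.
have mB q1 q2 q3 : measurable (B q1 q2 q3).
  rewrite /B; case: ifP => _; last exact: measurable0.
  by apply: measurableX; exact: measurable_itv.
have -> : D `&` F @^-1` `]c, +oo[ =
    D `&` \bigcup_q1 \bigcup_q2 \bigcup_q3 B q1 q2 q3.
  apply/seteqP; split => -[x y] [Dxy /=].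
  - rewrite in_itv/= andbT => cF; split => //.
    have e0 : 0 < F (x, y) - c by rewrite subr_gt0.
    have [d d0 Fd] := Fc x y Dxy _ e0.
    have d2 : 0 < d / 2 by rewrite divr_gt0.
    have [q3] := rat_in_itvoo d2; rewrite in_itv/= => /andP[q30 q3d].
    (* Any two points of a box of radius q3 < d/2 are at distance less than d. *)
    have near1 (v : R) : exists2 q : rat, (ratr q - ratr q3 : R) < v < ratr q + ratr q3 &
        forall v' : R, ratr q - ratr q3 < v' < ratr q + ratr q3 -> `|v' - v| < d.
      have vq : v - ratr q3 < v + ratr q3 by lra.
      have [q] := rat_in_itvoo vq; rewrite in_itv/= => /andP[qv vq'].
      exists q; first by lra.
      by move=> v' /andP[v1 v2]; rewrite ltr_norml; lra.
    have [q1 q1x q1d] := near1 x; have [q2 q2y q2d] := near1 y.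
    exists q1 => //; exists q2 => //; exists q3 => //; rewrite /B.
    case: asboolP => [_|]; first by split => /=; rewrite in_itv.
    case=> -[x' y'] [/=]; rewrite !in_itv/= => /q1d xx /q2d yy.
    have := Fd x' y' xx yy; rewrite ltr_norml => /andP[+ _]; lra.
  - move=> [q1 _ [q2 _ [q3 _]]]; rewrite /B.
    case: asboolP => // BF /BF/= cF; split => //.
    by rewrite in_itv/= cF.
apply: measurableI => //.
apply: bigcupT_measurable_rat => q1; apply: bigcupT_measurable_rat => q2.
exact: bigcupT_measurable_rat.
Qed.

Lemma continuous_real_coord (G : R[i] -> R) (x y : R) :
  {for Complex x y, continuous (G : R[i]^o -> R)} ->
  forall e, 0 < e -> exists2 d, 0 < d & forall x' y',
     `|x' - x| < d -> `|y' - y| < d -> `|G (Complex x' y') - G (Complex x y)| < e.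
Proof.
move=> /(@cvgrPdist_lt R R _ (nbhs (Complex x y : R[i]^o))) Gc e e0.
have /nbhs_ballP [d /= d0 hd] := Gc e e0.
have [d1 [d1E d2]] : exists d1 : R, d1%:C%C = d /\ 0 < d1.
  exists (complex.Re d); move: d0; rewrite ltcE /= => /andP[/eqP + ->].
  by case: (d) => ? ? /= ->.
exists (d1 / 2); first by rewrite divr_gt0.
move=> x' y' xx yy; rewrite distrC; apply: hd.
rewrite -ball_normE/= distrC cabs_norm -d1E ltcR.
apply: le_lt_trans (cabs_le_ReIm _) _; rewrite /= [ltRHS]splitr.
exact: ltrD.
Qed.

Definition disc : set RR := [set w : R * R | @unit_disc R (Complex w.1 w.2)].

Lemma measurable_disc : measurable disc.
Proof.
have mc : measurable_fun [set: RR] (fun w : RR => cabs (Complex w.1 w.2)).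
  apply: measurable_fun_locally_continuous => // x y _.
  apply: (continuous_real_coord (G := @cabs R)); exact: continuous_cabs.
have -> : disc = [set: RR] `&` (fun w : RR => cabs (Complex w.1 w.2)) @^-1` `]-oo, 1[.
  apply/seteqP; split => -[x y]; rewrite /disc /unit_disc/= in_itv/=; first by split.
  by case.
by apply: mc => //; exact: measurable_itv.
Qed.

Lemma continuous_measurable_disc (G : R[i] -> R) :
  (forall z, unit_disc z -> {for z, continuous (G : R[i]^o -> R)}) ->
  measurable_fun disc (fun w : RR => G (Complex w.1 w.2)).
Proof.
move=> Gc; apply: measurable_fun_locally_continuous; first exact: measurable_disc.
by move=> x y Dxy; exact: continuous_real_coord (Gc _ Dxy).
Qed.

Lemma continuous_comp_real (G : R[i] -> R) (h : R -> R) (z : R[i]) :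
  {for z, continuous (G : R[i]^o -> R)} -> {for G z, continuous h} ->
  {for z, continuous ((fun w => h (G w)) : R[i]^o -> R)}.
Proof. by move=> Gc hc; exact: (@continuous_comp R[i]^o R R G h z Gc hc). Qed.

Lemma continuous_powR (r x : R) : 0 < x -> {for x, continuous (fun y : R => y `^ r)}.
Proof.
move=> x0; apply: differentiable_continuous; apply/derivable1_diffP.
by apply: derivable_powR; rewrite in_itv/= x0.
Qed.

Lemma one_sub_conj_neq0 (a z : R[i]) : unit_disc a -> unit_disc z -> 1 - conjc a * z != 0.
Proof.
rewrite /unit_disc/= => a1 z1; rewrite subr_eq0; apply/eqP => E.
have : cabs (conjc a * z) = 1 by rewrite -E /cabs ComplexField.Normc.normc1.
rewrite cabsM cabs_conj => E1; have : cabs a * cabs z < 1 * 1 by rewrite ltr_pM ?cabs_ge0.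
by rewrite E1 mulr1 ltxx.
Qed.

Lemma one_sub_sigma (a z : R[i]) : unit_disc a -> unit_disc z ->
  1 - cabs (sigma_disc a z) ^+ 2 =
  (1 - cabs a ^+ 2) * (1 - cabs z ^+ 2) / cabs (1 - conjc a * z) ^+ 2.
Proof.
move=> a1 z1; have n0 := one_sub_conj_neq0 a1 z1.
have q0 : cabs (1 - conjc a * z) != 0 by rewrite cabs_eq0.
have key : cabs (1 - conjc a * z) ^+ 2 - cabs (a - z) ^+ 2 =
    (1 - cabs a ^+ 2) * (1 - cabs z ^+ 2).
  by rewrite !cabs_sqr; case: (a) => ? ?; case: (z) => ? ? /=; ring.
rewrite /sigma_disc cabsM cabsV -key.
by field.
Qed.

Lemma one_sub_sqr_gt0 (z : R[i]) : unit_disc z -> 0 < 1 - cabs z ^+ 2.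
Proof. by rewrite /unit_disc/= => z1; rewrite subr_gt0 exprn_ilt1// cabs_ge0. Qed.

Lemma one_sub_sigma_gt0 (a z : R[i]) : unit_disc a -> unit_disc z ->
  0 < 1 - cabs (sigma_disc a z) ^+ 2.
Proof.
move=> a1 z1; rewrite one_sub_sigma// divr_gt0//.
  by rewrite mulr_gt0 ?one_sub_sqr_gt0.
by rewrite exprn_gt0// cabs_gt0 one_sub_conj_neq0.
Qed.

Lemma sigma_continuous (a z : R[i]) : unit_disc a -> unit_disc z ->
  {for z, continuous (sigma_disc a : R[i]^o -> R[i]^o)}.
Proof.
move=> a1 z1.
have d1 : cderiv (fun w => 1 - conjc a * w) z (0 - (0 * z + conjc a * 1)).
  apply: (cderivB (f := fun=> 1) (g := fun w => conjc a * w)); first exact: cderiv_cst.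
  by apply: (cderivM (f := fun=> conjc a) (g := id)); [exact: cderiv_cst|exact: cderiv_id].
have d2 := cderivV (f := fun w => 1 - conjc a * w) (one_sub_conj_neq0 a1 z1) d1.
have d3 : cderiv (fun w => a - w) z (0 - 1).
  by apply: (cderivB (f := fun=> a) (g := id)); [exact: cderiv_cst|exact: cderiv_id].
exact: cderiv_continuous (cderivM (f := fun w => a - w)
  (g := fun w => (1 - conjc a * w)^-1) d3 d2).
Qed.

Lemma analytic_cderiv (f : R[i] -> R[i]) : analytic_disc f -> forall z, unit_disc z ->
  cderiv f z (cderive f z).
Proof. by move=> fa z /fa; exact: derivable_cderiv. Qed.

Lemma analytic_cderive_continuous (f : R[i] -> R[i]) : analytic_disc f ->
  forall z, unit_disc z -> {for z, continuous (cderive f : R[i]^o -> R[i]^o)}.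
Proof.
move=> fa z z1; apply: (@cderive_continuous _ f z (1 - cabs z)).
  by rewrite subr_gt0.
move=> w wz; exists (cderive f w); apply: analytic_cderiv => //.
rewrite /unit_disc/= -[w](subrK z); apply: le_lt_trans (cabsD _ _) _.
by rewrite -ltrBrDr.
Qed.

Lemma integrand_ge0 (p b : R) f (a z : R[i]) : 0 <= Qpb_integrand p b f a z.
Proof.
apply: mulr_ge0; last exact: powR_ge0.
by apply: mulr_ge0; [exact: sqr_ge0|exact: powR_ge0].
Qed.

Lemma measurable_integrand (p b : R) f (a : R[i]) : analytic_disc f -> unit_disc a ->
  measurable_fun disc (fun w : RR => Qpb_integrand p b f a (Complex w.1 w.2)).
Proof.
move=> fa a1; apply: (continuous_measurable_disc (G := Qpb_integrand p b f a)) => z z1.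
have sq_cont (h : R[i] -> R[i]) : {for z, continuous (h : R[i]^o -> R[i]^o)} ->
    {for z, continuous ((fun w => cabs (h w) ^+ 2) : R[i]^o -> R)}.
  move=> hc.
  have hc1 := @continuous_comp R[i]^o R[i]^o R h (@cabs R) z hc (@continuous_cabs R _).
  exact: (continuousM hc1 hc1).
have w_cont (h : R[i] -> R[i]) r : {for z, continuous (h : R[i]^o -> R[i]^o)} ->
    0 < 1 - cabs (h z) ^+ 2 ->
    {for z, continuous ((fun w => (1 - cabs (h w) ^+ 2) `^ r) : R[i]^o -> R)}.
  move=> hc h0.
  apply: (@continuous_comp_real (fun w => 1 - cabs (h w) ^+ 2) (fun y => y `^ r)).
    by apply: (@continuousB R R R[i]^o (fun=> 1) (fun w => cabs (h w) ^+ 2) z);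
      [exact: cst_continuous|exact: sq_cont].
  exact: continuous_powR.
apply: (@continuousM R R[i]^o (fun w => cabs (cderive f w) ^+ 2 * (1 - cabs w ^+ 2) `^ (4 * b - 4))
  (fun w => (1 - cabs (sigma_disc a w) ^+ 2) `^ (p + 2 - 2 * b)) z).
  apply: (@continuousM R R[i]^o (fun w => cabs (cderive f w) ^+ 2) (fun w => (1 - cabs w ^+ 2) `^
    (4 * b - 4)) z).
    exact: sq_cont (analytic_cderive_continuous fa z1).
  apply: (w_cont id); first exact: (cderiv_continuous (@cderiv_id R z)).
  exact: one_sub_sqr_gt0.
by apply: w_cont; [exact: sigma_continuous|exact: one_sub_sigma_gt0].
Qed.

End measurability.

(** * Growth of the derivative *)
Section growth.
Context {R : realType}.
Notation mu := (@lebesgue_measure R).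
Notation RR := (measurableTypeR R * measurableTypeR R)%type.
Implicit Types (p b : R) (f g : R[i] -> R[i]) (a z : R[i]).

Let disc_measure_integral (F : R[i] -> R) : \bar R :=
  (\int[(mu \x mu)%E]_(w in @disc R) (F (Complex w.1 w.2))%:E)%E.

Lemma disc_integralE (F : R[i] -> R) :
  disc_integral F = ((pi^-1)%:E * disc_measure_integral F)%E.
Proof. by []. Qed.

Lemma disc_integral_ge0 (F : R[i] -> R) : (forall z, 0 <= F z) -> (0 <= disc_integral F)%E.
Proof.
move=> F0; rewrite disc_integralE mule_ge0 ?lee_fin ?invr_ge0 ?pi_ge0//.
by apply: integral_ge0 => w _; rewrite lee_fin.
Qed.

Lemma Qpb_bound p b f : Qpb p b f -> exists2 N, 0 <= N & forall a, unit_disc a ->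
  (disc_integral (Qpb_integrand p b f a) <= (N ^+ 2)%:E)%E.
Proof.
move=> [fa fN].
set X := [set sqrte (disc_integral (Qpb_integrand p b f a)) | a in @unit_disc R].
have supX : (ereal_sup X < +oo)%E.
  rewrite ltNge leye_eq; apply/negP => /eqP E.
  by move: fN; rewrite /Qpb_norm -/X E.
have X0 : (0 <= ereal_sup X)%E.
  apply: le_ereal_sup_tmp; exists (sqrte (disc_integral (Qpb_integrand p b f 0))).
    by exists 0 => //; rewrite /unit_disc /mkset cabs0.
  exact: sqrte_ge0.
have XE : ereal_sup X = (fine (ereal_sup X))%:E by rewrite fineK// ge0_fin_numE.
exists (fine (ereal_sup X)); first exact: fine_ge0.
move=> a a1.
have I0 := disc_integral_ge0 (integrand_ge0 p b f a).
rewrite -lee_sqrt ?lee_fin ?sqr_ge0//= sqrtr_sqr ger0_norm ?fine_ge0// -XE.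
by apply: ereal_sup_ubound; exists a.
Qed.

Lemma Qpb_intro p b f N : 0 <= N -> analytic_disc f -> (forall a, unit_disc a ->
  (disc_integral (Qpb_integrand p b f a) <= (N ^+ 2)%:E)%E) -> Qpb p b f.
Proof.
move=> N0 fa fN; split => //.
apply: (@le_lt_trans _ _ ((cabs (f 0))%:E + N%:E)%E); last by rewrite -EFinD ltry.
rewrite /Qpb_norm leeD2l//; apply: ge_ereal_sup => _ [a a1 <-].
apply: (@le_trans _ _ (sqrte (N ^+ 2)%:E)).
  by rewrite lee_sqrt ?lee_fin ?sqr_ge0// fN.
by rewrite /= sqrtr_sqr ger0_norm.
Qed.

Let sub_sqr_le (x : R) : 1 - x ^+ 2 <= 2 * (1 - x).
Proof.
rewrite -subr_ge0 (_ : _ - _ = (1 - x) ^+ 2) ?sqr_ge0//.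
by ring.
Qed.

(** On the square of half side d/4 around a, with d = 1 - |a|, the two weights of
    the norm are comparable to their values at a: |z-a| <= d/2 gives
    d/2 <= 1-|z| <= 3d/2 and |1 - conj(a) z| <= 3d. *)
Lemma square_in_disc a z : unit_disc a ->
  on_rect (complex.Re a - (1 - cabs a) / 4) (complex.Re a + (1 - cabs a) / 4)
          (complex.Im a - (1 - cabs a) / 4) (complex.Im a + (1 - cabs a) / 4) z ->
  [/\ unit_disc z, 1 - cabs z ^+ 2 <= 3 * (1 - cabs a) &
      18^-1 <= 1 - cabs (sigma_disc a z) ^+ 2].
Proof.
move=> a1 /andP[]; set d := 1 - cabs a; set S := d / 4 => zx zy.
have d0 : 0 < d by rewrite subr_gt0.
have za : cabs (z - a) <= d / 2.
  apply: le_trans (cabs_le_ReIm _) _.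
  have -> : d / 2 = S + S by rewrite /S; field.
  by rewrite !raddfB/=; apply: lerD; rewrite ler_norml; lra.
have z_le : cabs z <= cabs a + d / 2.
  by rewrite -{1}[z](subrK a) addrC; apply: le_trans (cabsD _ _) _; rewrite lerD2l.
have a_le : cabs a <= cabs z + d / 2.
  rewrite -{1}[a](subrK z) addrC; apply: le_trans (cabsD _ _) _.
  by rewrite lerD2l -cabsN opprB.
have ca0 := cabs_ge0 a; have cz0 := cabs_ge0 z.
have ca : cabs a = 1 - d by rewrite /d; ring.
have z1 : cabs z < 1 by lra.
have h1 : 1 - cabs z ^+ 2 <= 3 * d.
  by apply: le_trans (sub_sqr_le _) _; lra.
split => //.
rewrite one_sub_sigma//.
have h2 : d / 2 <= 1 - cabs z ^+ 2.
  have : cabs z ^+ 2 <= cabs z by rewrite expr2; apply: ler_piMl; [exact: cabs_ge0|exact: ltW].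
  lra.
have h3 : d <= 1 - cabs a ^+ 2.
  have : cabs a ^+ 2 <= cabs a by rewrite expr2; apply: ler_piMl; [exact: cabs_ge0|exact: ltW].
  by rewrite /d; lra.
have h4 : cabs (1 - conjc a * z) <= 3 * d.
  have -> : 1 - conjc a * z = (1 - conjc a * a) + conjc a * (a - z) by ring.
  apply: le_trans (cabsD _ _) _.
  have -> : 1 - conjc a * a = (1 - cabs a ^+ 2)%:C%C.
    rewrite cabs_sqr; case: (a) => u v; apply/eqP; rewrite eq_complex/=.
    by apply/andP; split; apply/eqP; ring.
  rewrite cabsC cabsM cabs_conj -[cabs (a - z)]cabsN opprB ger0_norm; last lra.
  have e1 : cabs a * cabs (z - a) <= d / 2.
    apply: le_trans (ler_wpM2r (cabs_ge0 _) (ltW a1)) _; first by rewrite mul1r.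
  have e2 : 1 - cabs a ^+ 2 <= 2 * d := sub_sqr_le _.
  lra.
have q0 : 0 < cabs (1 - conjc a * z) by rewrite cabs_gt0 one_sub_conj_neq0.
rewrite ler_pdivlMr ?exprn_gt0//.
have q2 : cabs (1 - conjc a * z) ^+ 2 <= (3 * d) ^+ 2.
  by rewrite ler_pXn2r// nnegrE ?ltW// mulr_gt0.
have m2 : d * (d / 2) <= (1 - cabs a ^+ 2) * (1 - cabs z ^+ 2).
  by apply: ler_pM => //; rewrite ?ltW// divr_gt0.
apply: le_trans m2.
have -> : d * (d / 2) = 18^-1 * (3 * d) ^+ 2 by field.
by rewrite ler_pM2l.
Qed.

(** The constant 256 is 16 * 16: one factor is that of [local_L2_bound], the
    other comes from S^2 = (d/4)^2. *)
Let square_bound_of_area_bound (T l1 l2 e A q M : R) : 0 < l1 -> 0 < l2 -> 0 < q ->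
  T * l1 * ((e / 4) ^+ 2 * A / 16) <= M -> T * e ^+ 2 * q ^+ 2 = l2 ->
  A <= 256 * M / (l1 * l2) * q ^+ 2.
Proof.
move=> l10 l20 q0 LB E.
rewrite mulrAC ler_pdivlMr ?mulr_gt0//.
have -> : A * (l1 * l2) = 256 * q ^+ 2 * (T * l1 * ((e / 4) ^+ 2 * A / 16)).
  by rewrite -E; field.
have -> : 256 * M * q ^+ 2 = 256 * q ^+ 2 * M by ring.
by apply: ler_wpM2l LB; apply: (mulr_ge0 (ler0n _ 256)); exact: sqr_ge0.
Qed.

(** The supremum over a is used at each a only through the square of
    [square_in_disc]: there the weight is at least a constant times d^(4b-4),
    and [local_L2_bound] gains the area d^2. *)
Lemma Qpb_derivative_growth p b f : 0 < p -> b < 1 -> Qpb p b f ->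
  exists2 K, 0 <= K & forall a, unit_disc a ->
    cabs (cderive f a) <= K * (1 - cabs a) `^ (1 - 2 * b).
Proof.
move=> p0 b1 Qf; have [fa _] := Qf; have [N N0 fN] := Qpb_bound Qf.
pose k1 : R := (18^-1) `^ (p + 2 - 2 * b).
pose k2 : R := 3 `^ (4 * b - 4).
have k10 : 0 < k1 by apply: powR_gt0; rewrite invr_gt0.
have k20 : 0 < k2 by apply: powR_gt0.
pose C := 256 * (pi * N ^+ 2) / (k1 * k2).
have C0 : 0 <= C.
  apply: divr_ge0; last by rewrite ltW// mulr_gt0.
  by apply: (mulr_ge0 (ler0n _ 256)); apply: mulr_ge0; [exact: pi_ge0|exact: sqr_ge0].
exists (Num.sqrt C); first exact: sqrtr_ge0.
move=> a a1; set d := 1 - cabs a.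
have d0 : 0 < d by rewrite subr_gt0.
set S := d / 4.
have S0 : 0 < S by rewrite divr_gt0.
pose ka := (3 * d) `^ (4 * b - 4) * k1.
have ka0 : 0 <= ka by rewrite mulr_ge0 ?powR_ge0.
have fd z : on_rect (complex.Re a - S) (complex.Re a + S) (complex.Im a - S) (complex.Im a + S) z ->
    exists l, cderiv f z l.
  by move=> zQ; exists (cderive f z); apply: analytic_cderiv => //; have [] := square_in_disc a1 zQ.
have fc z : on_rect (complex.Re a - S) (complex.Re a + S) (complex.Im a - S) (complex.Im a + S) z ->
    {for z, continuous (cderive f : R[i]^o -> R[i]^o)}.
  by move=> zQ; apply: analytic_cderive_continuous => //; have [] := square_in_disc a1 zQ.
have := @local_L2_bound R f a S S0 fd fc (@disc R)
  (fun w => Qpb_integrand p b f a (Complex w.1 w.2)) ka ka0 (@measurable_disc R)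
  (measurable_integrand p b fa a1) (fun w _ => integrand_ge0 p b f a _).
move=> LB.
have {LB} : ((ka * (S ^+ 2 * cabs (cderive f a) ^+ 2 / 16))%:E <=
    disc_measure_integral (Qpb_integrand p b f a))%E.
  apply: LB => x y zQ; have [z1 h1 h2] := square_in_disc a1 zQ; split => //.
  suff : ka * cabs (cderive f (Complex x y)) ^+ 2 <= Qpb_integrand p b f a (Complex x y) by [].
  have zp := one_sub_sqr_gt0 z1.
  have dp : 0 < 3 * d by rewrite mulr_gt0.
  move: (Complex x y) z1 h1 h2 zp {zQ} => z z1 h1 h2 zp.
  rewrite /Qpb_integrand /ka mulrC -mulrA; apply: ler_wpM2l; first exact: sqr_ge0.
  apply: ler_pM; rewrite ?powR_ge0//; last first.
    apply: ge0_ler_powR => //.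
    - lra.
    - by rewrite nnegrE invr_ge0.
    - by rewrite nnegrE ltW// one_sub_sigma_gt0.
  have -> : 4 * b - 4 = - (4 - 4 * b) by ring.
  rewrite !powRN lef_pV2 ?posrE ?powR_gt0//.
  by apply: ge0_ler_powR => //; [lra|rewrite nnegrE ltW|rewrite nnegrE ltW].
move=> LB.
have {LB} : ka * (S ^+ 2 * cabs (cderive f a) ^+ 2 / 16) <= pi * N ^+ 2.
  have := fN a a1; rewrite disc_integralE => fNa.
  rewrite -lee_fin; apply: le_trans LB _.
  have := lee_wpmul2l (x := pi%:E) _ fNa.
  rewrite lee_fin pi_ge0 => /(_ isT).
  by rewrite muleA -EFinM mulfV ?gt_eqF ?pi_gt0// mul1e.
move=> LB.
have dE : (3 * d) `^ (4 * b - 4) * d ^+ 2 * (d `^ (1 - 2 * b)) ^+ 2 = k2.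
  have dn0 : d != 0 by rewrite gt_eqF.
  rewrite powRM ?(ltW d0)// -/k2.
  rewrite -!powR_mulrn ?powR_ge0 ?(ltW d0)// -powRrM -!mulrA -!powRD ?dn0 ?implybT//.
  have -> : 4 * b - 4 + (2%:R + (1 - 2 * b) * 2%:R) = 0 by ring.
  by rewrite powRr0 mulr1.
have dp : 0 < d `^ (1 - 2 * b) by exact: powR_gt0.
rewrite -(@ler_pXn2r _ 2)// ?nnegrE ?cabs_ge0 ?mulr_ge0 ?sqrtr_ge0 ?(ltW dp)//.
rewrite exprMn sqr_sqrtr//.
move: LB dE; rewrite /ka /S; exact: (square_bound_of_area_bound k10 k20 dp).
Qed.

End growth.

(** * Boundedness and products *)
Section algebra.
Context {R : realType}.
Notation mu := (@lebesgue_measure R).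
Notation RR := (measurableTypeR R * measurableTypeR R)%type.
Implicit Types (p b : R) (f g : R[i] -> R[i]) (a z : R[i]).

(** Along the radius to a, the derivative bound K (1-t|a|)^(1-2b) |a| has the
    bounded primitive - (K/s) (1-t|a|)^s with s = 2-2b > 0.  Comparing f with
    this primitive through the monotonicity of one real function avoids
    integrating f'. *)
Lemma Qpb_bounded p b f : 0 < p -> b < 1 -> Qpb p b f ->
  exists2 M, 0 <= M & forall z, unit_disc z -> cabs (f z) <= M.
Proof.
move=> p0 b1 Qf; have [fa _] := Qf.
have [K K0 fK] := Qpb_derivative_growth p0 b1 Qf.
pose s := 2 - 2 * b.
have s0 : 0 < s by rewrite /s; lra.
have Ks : 0 <= K / s by rewrite divr_ge0// ltW.
exists (cabs (f 0) + K / s); first by rewrite addr_ge0 ?cabs_ge0.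
move=> a a1.
have [/eqP|w0] := eqVneq (f a - f 0) 0.
  by rewrite subr_eq0 => /eqP ->; rewrite lerDl.
(* The unimodular u rotates f(a) - f(0) onto the positive real axis. *)
pose w := f a - f 0.
pose u := conjc w / (cabs w)%:C%C.
have cw : 0 < cabs w by rewrite cabs_gt0.
have cwC : (cabs w)%:C%C != 0 :> R[i] by rewrite -cabs_eq0 cabsC gt_eqF ?normr_gt0 ?gt_eqF.
have u1 : cabs u = 1.
  by rewrite cabsM cabsV cabsC cabs_conj ger0_norm ?cabs_ge0// mulfV ?gt_eqF.
have uw : u * w = (cabs w)%:C%C.
  have ww : conjc w * w = (cabs w)%:C%C * (cabs w)%:C%C.
    rewrite -rmorphM/= -expr2 cabs_sqr; case: (w) => x y; apply/eqP; rewrite eq_complex/=.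
    by apply/andP; split; apply/eqP; ring.
  by rewrite /u mulrAC ww mulfK.
clearbody u.
pose phi (t : R) := complex.Re (u * f (t%:C%C * a)) + K / s * (1 - t * cabs a) `^ s.
have ta1 (t : R) : 0 <= t <= 1 -> 0 < 1 - t * cabs a.
  move=> /andP[t0 t1]; rewrite subr_gt0; apply: le_lt_trans a1.
  by apply: ler_piMl => //; exact: cabs_ge0.
have tad (t : R) : 0 <= t <= 1 -> unit_disc (t%:C%C * a).
  move=> t01; rewrite /unit_disc/= cabsM cabsC ger0_norm; last by case/andP: t01.
  by rewrite -subr_gt0; exact: ta1.
have dphi (t : R) : 0 <= t <= 1 -> is_derive t 1 phi (complex.Re (u * (a * cderive f (t%:C%C *
  a))) -
    K * cabs a * (1 - t * cabs a) `^ (1 - 2 * b)).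
  move=> t01.
  have d1 : is_derive t 1 (fun t : R => complex.Re (u * f (t%:C%C * a)))
      (complex.Re (u * (a * cderive f (t%:C%C * a)))).
    have H : cderiv f (0 + t%:C%C * a) (cderive f (t%:C%C * a)).
      by rewrite add0r; apply: analytic_cderiv => //; exact: tad.
    have H2 := cderiv_line H.
    have H3 : cderiv (fun x => u * f (0 + x * a)) t%:C%C
        (0 * f (0 + t%:C%C * a) + u * (a * cderive f (t%:C%C * a))).
      exact: (cderivM (f := fun=> u) (g := fun x => f (0 + x * a)) (cderiv_cst u _) H2).
    have := is_derive_Re H3; rewrite mul0r add0r.
    by under eq_fun do rewrite add0r.
  have d2 : is_derive t 1 (fun t : R => (1 - t * cabs a) `^ s)
      ((s * (1 - t * cabs a) `^ (1 - 2 * b)) * (- cabs a)).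
    have dp : is_derive (1 - t * cabs a) 1 (fun y : R => y `^ s) (s * (1 - t * cabs a) `^ (1 - 2
      * b)).
      have pos : 1 - t * cabs a \in `]0, +oo[ by rewrite in_itv/= ta1.
      have -> : 1 - 2 * b = s - 1 by rewrite /s; ring.
      apply: DeriveDef; first exact: derivable_powR.
      by rewrite -derive1E powR_derive1.
    have dl : is_derive t 1 (fun t : R => 1 - t * cabs a) (- cabs a).
      have := is_deriveB (is_derive_cst (1 : R) t 1)
        (is_deriveM (is_derive_id t 1) (is_derive_cst (cabs a) t 1)).
      by move=> H; apply: (is_derive_eq H); rewrite scaler0 !add0r [_ *: _]mulr1.
    exact: (@is_derive1_comp R (fun y : R => y `^ s) (fun t : R => 1 - t * cabs a) t _ _ dp dl).
  have -> : complex.Re (u * (a * cderive f (t%:C%C * a))) - K * cabs a * (1 - t * cabs a) `^ (1 -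
    2 * b) =
    complex.Re (u * (a * cderive f (t%:C%C * a))) +
     K / s * ((s * (1 - t * cabs a) `^ (1 - 2 * b)) * (- cabs a)).
    by congr (_ + _); field; rewrite gt_eqF.
  exact: is_deriveD d1 (is_deriveZ (K / s) d2).
have noninc : phi 1 <= phi 0.
  apply: (@ler0_derive1_le_cc _ phi 0 1).
  - by move=> t; rewrite in_itv/= => /andP[/ltW t0 /ltW t1]; have [] := dphi t (introT andP (conj
    t0 t1)).
  - move=> t; rewrite in_itv/= => /andP[/ltW t0 /ltW t1].
    have t01 := introT andP (conj t0 t1).
    rewrite derive1E; have [_ ->] := dphi t t01.
    rewrite subr_le0; apply: le_trans (ler_norm _) _; apply: le_trans (ler_Re_cabs _) _.
    rewrite !cabsM u1 mul1r mulrC mulrAC.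
    apply: ler_wpM2r; first exact: cabs_ge0.
    have := fK _ (tad t t01).
    by rewrite cabsM cabsC ger0_norm.
  - apply: continuous_in_subspaceT => t; rewrite inE/= in_itv/= => /dphi [ft _].
    by apply: differentiable_continuous; apply/derivable1_diffP.
  - by rewrite in_itv/= lexx ler01.
  - by rewrite in_itv/= lexx ler01.
  - by [].
have ReB : complex.Re (u * f a) - complex.Re (u * f 0) = cabs w.
  by rewrite -raddfB/= -mulrBr -/w uw.
have fw : cabs w <= K / s.
  move: noninc; rewrite /phi (mul0r (cabs a)) (mul1r (cabs a)) subr0 powR1 mulr1.
  rewrite (mul0r a) (mul1r a) => H.
  have : 0 <= K / s * (1 - cabs a) `^ s by rewrite mulr_ge0// powR_ge0.
  have arith (q r e h c : R) : q - r = e -> 0 <= h -> q + h <= r + c -> e <= c by lra.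
  by move=> h0; exact: arith ReB h0 H.
have -> : f a = f 0 + w by rewrite /w addrC subrK.
by apply: le_trans (cabsD _ _) _; rewrite lerD2l.
Qed.

Lemma analyticM f g : analytic_disc f -> analytic_disc g ->
  analytic_disc (fun z => f z * g z).
Proof.
move=> fa ga z z1.
exact: cderiv_derivable (cderivM (analytic_cderiv fa z1) (analytic_cderiv ga z1)).
Qed.

Let square_sum (q x y m n : R) : q <= x * m + n * y -> 0 <= q ->
  q ^+ 2 <= 2 * m ^+ 2 * x ^+ 2 + 2 * n ^+ 2 * y ^+ 2.
Proof.
move=> qs q0; apply: (@le_trans _ _ ((x * m + n * y) ^+ 2)).
  by rewrite ler_pXn2r// nnegrE// (le_trans q0).
rewrite -subr_ge0 (_ : _ - _ = (x * m - n * y) ^+ 2) ?sqr_ge0//.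
by ring.
Qed.

Let combine_scaled (k c1 c2 u v : R) (A B : \bar R) : 0 <= c1 -> 0 <= c2 ->
  (0 <= A)%E -> (0 <= B)%E -> (k%:E * A <= u%:E)%E -> (k%:E * B <= v%:E)%E ->
  (k%:E * (c1%:E * A + c2%:E * B) <= (c1 * u + c2 * v)%:E)%E.
Proof.
move=> c10 c20 A0 B0 Au Bv.
rewrite ge0_muleDr ?mule_ge0 ?lee_fin// EFinD !EFinM (muleCA k%:E) (muleCA k%:E c2%:E).
by apply: leeD; apply: lee_wpmul2l; rewrite ?lee_fin.
Qed.

(** Boundedness of both factors and the product rule bound the integrand of f g
    by a combination of the integrands of f and g, uniformly in a. *)
Lemma QpbM p b f g (Mf Mg : R) : 0 <= Mf -> 0 <= Mg ->
  (forall z, unit_disc z -> cabs (f z) <= Mf) ->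
  (forall z, unit_disc z -> cabs (g z) <= Mg) ->
  Qpb p b f -> Qpb p b g -> Qpb p b (fun z => f z * g z).
Proof.
move=> Mf0 Mg0 fM gM Qf Qg; have [fa _] := Qf; have [ga _] := Qg.
have [Nf Nf0 fN] := Qpb_bound Qf; have [Ng Ng0 gN] := Qpb_bound Qg.
have fga := analyticM fa ga.
pose N2 := 2 * Mg ^+ 2 * Nf ^+ 2 + 2 * Mf ^+ 2 * Ng ^+ 2.
have c1 : 0 <= 2 * Mg ^+ 2 by rewrite mulr_ge0// sqr_ge0.
have c2 : 0 <= 2 * Mf ^+ 2 by rewrite mulr_ge0// sqr_ge0.
have N20 : 0 <= N2 by rewrite addr_ge0// mulr_ge0// sqr_ge0.
apply: (@Qpb_intro _ p b _ (Num.sqrt N2)); [exact: sqrtr_ge0|exact: fga|].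
move=> a a1; rewrite sqr_sqrtr//.
have pw z : unit_disc z -> Qpb_integrand p b (fun z => f z * g z) a z <=
    2 * Mg ^+ 2 * Qpb_integrand p b f a z + 2 * Mf ^+ 2 * Qpb_integrand p b g a z.
  move=> z1.
  have dM : cderive (fun z => f z * g z) z = cderive f z * g z + f z * cderive g z.
    exact: cderiv_derive1 (cderivM (analytic_cderiv fa z1) (analytic_cderiv ga z1)).
  pose W := (1 - cabs z ^+ 2) `^ (4 * b - 4) * (1 - cabs (sigma_disc a z) ^+ 2) `^ (p + 2 - 2 * b).
  have W0 : 0 <= W by apply: mulr_ge0; exact: powR_ge0.
  have IE h : Qpb_integrand p b h a z = cabs (cderive h z) ^+ 2 * W.
    by rewrite /Qpb_integrand -mulrA.
  rewrite !IE dM.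
  clearbody W.
  rewrite (mulrA _ _ W) (mulrA _ _ W) -mulrDl; apply: ler_wpM2r => //.
  have tri : cabs (cderive f z * g z + f z * cderive g z) <=
      cabs (cderive f z) * Mg + Mf * cabs (cderive g z).
    apply: le_trans (cabsD _ _) _; rewrite !cabsM; apply: lerD.
      by apply: ler_wpM2l; [exact: cabs_ge0|exact: gM].
    by apply: ler_wpM2r; [exact: cabs_ge0|exact: fM].
  exact: square_sum tri (cabs_ge0 _).
have mf := measurable_integrand p b fa a1.
have mg := measurable_integrand p b ga a1.
have mfg := measurable_integrand p b fga a1.
rewrite disc_integralE.
have fNa := fN a a1; have gNa := gN a a1.
rewrite (disc_integralE (Qpb_integrand p b f a)) in fNa.
rewrite (disc_integralE (Qpb_integrand p b g a)) in gNa.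
have mE (F : RR -> R) : measurable_fun (@disc R) F -> measurable_fun (@disc R) (EFin \o F).
  exact: measurableT_comp.
have mIf : measurable_fun (@disc R) (fun w : RR => ((2 * Mg ^+ 2)%:E * (Qpb_integrand p b f a
  (Complex w.1 w.2))%:E)%E).
  exact: (measurable_funeM _ (mE _ mf)).
have mIg : measurable_fun (@disc R) (fun w : RR => ((2 * Mf ^+ 2)%:E * (Qpb_integrand p b g a
  (Complex w.1 w.2))%:E)%E).
  exact: (measurable_funeM _ (mE _ mg)).
set A := (\int[_]_(w in _) (Qpb_integrand p b f _ _)%:E)%E in fNa.
set B := (\int[_]_(w in _) (Qpb_integrand p b g _ _)%:E)%E in gNa.
have A0 : (0 <= A)%E by apply: integral_ge0 => w _; rewrite lee_fin integrand_ge0.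
have B0 : (0 <= B)%E by apply: integral_ge0 => w _; rewrite lee_fin integrand_ge0.
have le1 : (\int[(mu \x mu)%E]_(w in @disc R) (Qpb_integrand p b (fun z => f z * g z) a (Complex
  w.1 w.2))%:E <=
   (2 * Mg ^+ 2)%:E * A + (2 * Mf ^+ 2)%:E * B)%E.
  have EA : ((2 * Mg ^+ 2)%:E * A = \int[(mu \x mu)%E]_(w in @disc R)
      ((2 * Mg ^+ 2)%:E * (Qpb_integrand p b f a (Complex w.1 w.2))%:E))%E.
    apply/esym; apply: ge0_integralZl; [exact: measurable_disc|exact: (mE _ mf)| |].
    - by move=> w _; rewrite lee_fin integrand_ge0.
    - by rewrite lee_fin.
  have EB : ((2 * Mf ^+ 2)%:E * B = \int[(mu \x mu)%E]_(w in @disc R)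
      ((2 * Mf ^+ 2)%:E * (Qpb_integrand p b g a (Complex w.1 w.2))%:E))%E.
    apply/esym; apply: ge0_integralZl; [exact: measurable_disc|exact: (mE _ mg)| |].
    - by move=> w _; rewrite lee_fin integrand_ge0.
    - by rewrite lee_fin.
  have scaled_ge0 (k : R) h w : 0 <= k ->
      (0 <= k%:E * (Qpb_integrand p b h a w)%:E)%E.
    by move=> k0; rewrite mule_ge0 ?lee_fin ?integrand_ge0.
  rewrite EA EB -ge0_integralD; first last.
  - exact: mIg.
  - by move=> w _; exact: scaled_ge0.
  - exact: mIf.
  - by move=> w _; exact: scaled_ge0.
  - exact: measurable_disc.
  apply: ge0_le_integral.
  - exact: measurable_disc.
  - by move=> w _; rewrite lee_fin integrand_ge0.
  - exact: (mE _ mfg).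
  - exact: (emeasurable_funD mIf mIg).
  - by move=> [x y] Dxy; rewrite -!EFinM -EFinD lee_fin; exact: pw.
have pi0 : (0 <= (pi^-1)%:E :> \bar R)%E by rewrite lee_fin invr_ge0 pi_ge0.
apply: le_trans (lee_wpmul2l pi0 le1) _.
exact: combine_scaled c1 c2 A0 B0 fNa gNa.
Qed.

Lemma Qpb1 p b : Qpb p b (fun=> 1).
Proof.
apply: (@Qpb_intro _ p b _ 0); first exact: lexx.
  by move=> z _; exact: (cderiv_derivable (@cderiv_cst R 1 z)).
move=> a a1; rewrite /disc_integral.
rewrite integral0_eq ?mule0 ?expr0n//= => w _.
rewrite /Qpb_integrand (cderiv_derive1 (@cderiv_cst R 1 _)).
by rewrite cabs0 expr0n/= !mul0r.
Qed.

End algebra.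

Theorem theorem6 (R : realType) (p b : R)
  (hp0 : 0 < p) (hp1 : p <= 1) (hb0 : 1 / 2 < b) (hb1 : b < 1) :
  multipliers (Qpb p b) = Qpb p b.
Proof.
apply/seteqP; split => g.
- move=> [_ /(_ _ (Qpb1 p b))].
  by under eq_fun do rewrite mulr1.
- move=> Qg; split; first by case: Qg.
  move=> f Qf.
  have [Mf Mf0 fM] := Qpb_bounded hp0 hb1 Qf.
  have [Mg Mg0 gM] := Qpb_bounded hp0 hb1 Qg.
  exact: QpbM Mg0 Mf0 gM fM Qg Qf.
Qed.
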